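(* Let $G \in \mathscr S$. Then exactly one of the following holds. (a) $\mathcal{LN}(G) = \{0, \infty\}$, and every compact open subgroup of $G$ is hereditarily just-infinite. (b) $\mathcal{LN}(G)$ is infinite, non-atomic, the $G$-action on $\mathcal{LN}(G)$ is faithful, and $\mathcal{LC}(G) = \{0, \infty\}$. (c) $\mathcal{LC}(G)$ is infinite, non-atomic, and $\mathcal{LD}(G) = \{0, \infty\}$. (d) $\mathcal{LD}(G)$ is infinite and non-atomic. (e) $\mathcal{LN}(G) \neq \{0, \infty\}$, $\mathcal{LC}(G) = \{0, \infty\}$ and the $G$-action on $\mathcal{LN}(G)$ is trivial.
   Context: $\mathscr S$ denotes the class of compactly generated locally compact groups that are totally disconnected, topologically simple, and non-discrete. A locally normal subgroup of $G$ is a compact subgroup whose normaliser in $G$ is open. Two subgroups are commensurable if their intersection has finite index in each of them. The structure lattice $\mathcal{LN}(G)$ is the set of commensurability classes $[K]$ of locally normal subgroups $K$ of $G$, with the partial order $\leq$ induced by inclusion ($[K] \leq [L]$ iff $K \cap L$ has finite index in $K$). It is a modular lattice with join $\vee$, meet $\wedge$, minimum $0$ (class of the trivial subgroup) and maximum $\infty$ (class of the compact open subgroups). $G$ acts on it by automorphisms via conjugation, $g.[K]=[gKg^{-1}]$. For $\alpha \in \mathcal{LN}(G)$, choose a representative $K$ of $\alpha$ that is a closed normal subgroup of some compact open subgroup $U$ of $G$; the centraliser $\mathrm C_U(K)$ is a locally normal subgroup of $G$ whose commensurability class depends only on $\alpha$, and this class is denoted $\alpha^\perp$. The centraliser lattice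 is $\mathcal{LC}(G) = \{\alpha^\perp \mid \alpha \in \mathcal{LN}(G)\}$; with join $\alpha \vee' \beta = (\alpha^\perp \wedge \beta^\perp)^\perp$, meet $\wedge$ and complement $\perp$ it is a Boolean lattice. The decomposition lattice is $\mathcal{LD}(G) = \{\alpha \in \mathcal{LN}(G) \mid \alpha \vee \alpha^\perp = \infty\}$; it is contained in $\mathcal{LC}(G)$ and is a Boolean lattice under $\vee, \wedge, \perp$. An atom of a lattice with minimum $0$ is a non-zero element that is not minorized by any other non-zero element; a lattice is non-atomic if it contains no atom. A profinite group is hereditarily just-infinite if it is infinite and, for every open subgroup $V$, every non-trivial closed normal subgroup of $V$ has finite index in $V$. *)

(* Defs.v *)
From HB Require Import structures.
From mathcomp Require Import all_boot all_order all_algebra.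
From mathcomp Require Import all_classical topology.

Set Implicit Arguments.
Unset Strict Implicit.
Unset Printing Implicit Defensive.

Local Open Scope classical_set_scope.
Local Open Scope group_scope.

HB.mixin Record isTopologicalGroup G of Topological G & Group G := {
  mulg_continuous : continuous (fun x : G * G => x.1 * x.2) ;
  invg_continuous : continuous (fun x : G => x^-1)
}.

#[short(type="topologicalGroupType")]
HB.structure Definition TopologicalGroup :=
  {G of Topological G & Group G & isTopologicalGroup G}.

Implicit Types G : topologicalGroupType.

Definition subgroup G (H : set G) : Prop := group_closed [in H].

(* g H g^-1; the boot conjugation x ^ g is g^-1 x g. *)
Definition conj_set G (g : G) (H : set G) : set G :=
  [set g * x * g^-1 | x in H].

Definition normaliser G (H : set G) : set G := [set g | conj_set g H = H].

Definition centraliser G (U K : set G) : set G :=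
  [set u | U u /\ forall k, K k -> u * k = k * u].

Definition normal_subgroup G (U N : set G) : Prop :=
  [/\ subgroup N, N `<=` U & U `<=` normaliser N].

(* The set of left cosets x H, x in K, is finite. *)
Definition finite_index G (K H : set G) : Prop :=
  finite_set [set [set x * h | h in H] | x in K].

Definition commensurable G (K L : set G) : Prop :=
  finite_index K (K `&` L) /\ finite_index L (K `&` L).

Definition compact_open_subgroup G (U : set G) : Prop :=
  [/\ subgroup U, compact U & open U].

Definition locally_normal G (K : set G) : Prop :=
  [/\ subgroup K, compact K & open (normaliser K)].

(* Locally compact groups are Hausdorff by convention. *)
Definition compactly_generated_lc G : Prop :=
  [/\ hausdorff_space G, locally_compact [set: G] &
      exists2 K : set G, compact K & smallest (@subgroup G) K = setT].

Definition topologically_simple G : Prop :=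
  [set: G] <> [set 1] /\
  forall N : set G, closed N -> normal_subgroup setT N ->
    N = [set 1] \/ N = setT.

Definition non_discrete G : Prop := ~ forall A : set G, open A.

Definition class_S G : Prop :=
  [/\ compactly_generated_lc G, totally_disconnected [set: G],
      topologically_simple G & non_discrete G].

Definition comm_class G (K : set G) : set (set G) :=
  [set L | locally_normal L /\ commensurable K L].

Definition LN G : set (set (set G)) :=
  [set comm_class K | K in @locally_normal G].
Arguments LN G : clear implicits.

Definition LN_le G (a b : set (set G)) : Prop :=
  exists K L, [/\ a K, b L & finite_index K (K `&` L)].

Definition LN0 G : set (set G) := comm_class [set 1].
Arguments LN0 G : clear implicits.

(* All compact open subgroups are commensurable, so this union is the class of
   any one of them. *)
Definition LNoo G : set (set G) :=
  \bigcup_(U in @compact_open_subgroup G) comm_class U.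
Arguments LNoo G : clear implicits.

Definition LN_conj G (g : G) (a : set (set G)) : set (set G) :=
  [set conj_set g K | K in a].

Definition LN_join G (a b c : set (set G)) : Prop :=
  [/\ LN G c, LN_le a c, LN_le b c &
      forall d, LN G d -> LN_le a d -> LN_le b d -> LN_le c d].

(* For G in class_S the class of C_U(K) does not depend on the pair (K, U), so
   this union is the class given by any one choice. *)
Definition perp G (a : set (set G)) : set (set G) :=
  \bigcup_(p in [set p : set G * set G |
      [/\ a p.1, compact_open_subgroup p.2, closed p.1
        & normal_subgroup p.2 p.1]])
    comm_class (centraliser p.2 p.1).

Definition LC G : set (set (set G)) := [set perp a | a in LN G].
Arguments LC G : clear implicits.

Definition LD G : set (set (set G)) :=
  [set a | LN G a /\ LN_join a (perp a) (LNoo G)].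
Arguments LD G : clear implicits.

(* For L one of LN, LC, LD: the orders of the latter two are restrictions of
   that of LN, and they share the minimum. *)
Definition atom G (L : set (set (set G))) (a : set (set G)) : Prop :=
  [/\ L a, a <> LN0 G &
      forall b, L b -> b <> LN0 G -> LN_le b a -> b = a].

Definition non_atomic G (L : set (set (set G))) : Prop :=
  ~ exists a, atom L a.

Definition faithful_action G (L : set (set (set G))) : Prop :=
  forall g : G, (forall a, L a -> LN_conj g a = a) -> g = 1.

Definition trivial_action G (L : set (set (set G))) : Prop :=
  forall (g : G) a, L a -> LN_conj g a = a.

(* P is a profinite subgroup; "open in P" and "closed in V" refer to the
   subspace topologies. *)
Definition hereditarily_just_infinite G (P : set G) : Prop :=
  infinite_set P /\
  forall V : set G, subgroup V -> V `<=` P -> open (V : set (subspace P)) ->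
  forall N : set G, closed (N : set (subspace V)) -> normal_subgroup V N ->
    N <> [set 1] -> finite_index V N.

(* Main.v *)
Require Import Defs.
From HB Require Import structures.
From mathcomp Require Import all_boot all_order all_algebra.
From mathcomp Require Import all_classical topology.

(* Locally normal subgroups are handled through their germs at [1]: for compact
   subgroups, [K] lies below [L] up to finite index iff elements of [K] near [1]
   are in [L].

   The key fact is that a nontrivial locally normal [K] has finitely many
   conjugates whose germs are centralised by no nontrivial element of [G]. As [G]
   is generated by a compact open subgroup and finitely many elements of
   conjugates of [K], this reduces to the principle behind the triviality of the
   quasi-centre: a nontrivial normal subgroup of elements commuting with germs
   would supply finitely many generators commuting with one and the same
   nontrivial germ, hence a proper closed normal subgroup. It follows that [G] has
   no nontrivial abelian locally normal subgroup, so that the complement of a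
   class is well defined, and that a nonzero element of [LN G] fixed by [G] has
   zero complement.

   An atom of [LC G] or [LD G] meets its other conjugates trivially, so its orbit
   lies in the above finite family; hence it is fixed by [G] and equals the
   maximum. When [LC G] is trivial, nonzero elements of [LN G] never meet
   trivially, so an atom of [LN G] lies below all of them, and then all of them
   are fixed by [G]. The action is faithful or trivial, its kernel being a closed
   normal subgroup. *)

Set Implicit Arguments.
Unset Strict Implicit.
Unset Printing Implicit Defensive.

Local Open Scope classical_set_scope.
Local Open Scope group_scope.

(** The sets [C y] need not be open: each point of [K] only needs a neighbourhood whose trace on [K]
    lies in one of them. This suits fibres of locally constant maps. *)
Lemma compact_finite_subcover (T : topologicalType) (Y : Type) (K : set T)
    (D : set Y) (C : Y -> set T) :
  compact K ->
  (forall x, K x -> exists2 y, D y & \forall z \near x, K z -> C y z) ->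
  exists S : set Y, [/\ finite_set S, S `<=` D & K `<=` \bigcup_(y in S) C y].
Proof.
move=> /compact_near_coveringP/near_covering_withinP cK CK.
(* [F] is generated by the up-sets of the finite subsets of [D]; the near-covering form of
   compactness along [F] yields one finite set of indices serving all of [K]. *)
pose F := filter_from [set S : set Y | finite_set S /\ S `<=` D]
  (fun S => [set S' | S `<=` S' /\ (finite_set S' /\ S' `<=` D)]).
have FF : Filter F.
  apply: filter_from_filter; first by exists set0; split; [exact: finite_set0|exact: sub0set].
  move=> A B [fA AD] [fB BD]; exists (A `|` B).
    by split; [rewrite finite_setU | rewrite subUset].
  by move=> S' [] /= + [fS SD]; rewrite subUset => -[AS BS].
have [x Kx|S [fS SD] /(_ S)] := cK _ F (fun S x => (\bigcup_(y in S) C y) x) FF.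
  have [y Dy Cy] := CK x Kx.
  exists ([set z | K z -> C y z], [set S' | [set y] `<=` S' /\ (finite_set S' /\ S' `<=` D)]).
    split => //=; exists [set y] => //; split; first exact: finite_set1.
    by move=> _ ->.
  by move=> [z S'] /= [Cz [yS' _]] Kz; exists y; [exact: yS'|exact: Cz].
by move=> /(_ (conj (@subset_refl _ S) (conj fS SD))) KS; exists S.
Qed.

(** * Topological groups *)

Section GroupTopology.
Variable G : topologicalGroupType.
Implicit Types (g h x y : G) (H K L U V W : set G).

Lemma subgroupP H :
  subgroup H <-> H 1 /\ forall x y, H x -> H y -> H (x * y^-1).
Proof.
split=> [[H1 Hd]|[H1 Hd]]; split.
- exact: set_mem.
- by move=> x y Hx Hy; apply/set_mem/Hd; exact: mem_set.
- exact: mem_set.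
- by move=> x y /set_mem Hx /set_mem Hy; apply/mem_set/Hd.
Qed.

Lemma subgroup1 H : subgroup H -> H 1.
Proof. by move=> /subgroupP[]. Qed.

Lemma subgroupV H x : subgroup H -> H x -> H x^-1.
Proof. by move=> /subgroupP[H1 Hd] Hx; rewrite -[x^-1]mul1g; exact: Hd. Qed.

Lemma subgroupM H x y : subgroup H -> H x -> H y -> H (x * y).
Proof.
move=> sH Hx Hy; rewrite -[y]invgK; have /subgroupP[_] := sH; apply => //.
exact: subgroupV.
Qed.

Lemma subgroupVE H x : subgroup H -> H x^-1 = H x.
Proof.
by move=> sH; apply/propext; split=> /(subgroupV sH) //; rewrite invgK.
Qed.

Lemma subgroupMl H x y : subgroup H -> H x -> H (x * y) = H y.
Proof.
move=> sH Hx; apply/propext; split; last exact: subgroupM.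
by move=> /(subgroupM sH (subgroupV sH Hx)); rewrite mulKg.
Qed.

Lemma subgroupMr H x y : subgroup H -> H y -> H (x * y) = H x.
Proof.
move=> sH Hy; apply/propext; split; last by move=> ?; exact: subgroupM.
by move=> Hxy; have := subgroupM sH Hxy (subgroupV sH Hy); rewrite mulgK.
Qed.

Lemma subgroupI H K : subgroup H -> subgroup K -> subgroup (H `&` K).
Proof.
move=> sH sK; apply/subgroupP; split; first by split; exact: subgroup1.
move=> x y [Hx Kx] [Hy Ky].
by split; apply: subgroupM => //; exact: subgroupV.
Qed.

Lemma subgroup_set1 : subgroup [set (1 : G)].
Proof. by apply/subgroupP; split => // x y -> ->; rewrite /= mulgV. Qed.

Lemma conj_setE g H : conj_set g H = [set x | H (g^-1 * x * g)].
Proof.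
apply/seteqP; split=> [_ [x Hx <-]|x /= Hx]; first by rewrite /= !gnorm.
by exists (g^-1 * x * g) => //; rewrite !gnorm.
Qed.

Lemma conj_set1g H : conj_set 1 H = H.
Proof. by rewrite conj_setE; apply/seteqP; split=> x /=; rewrite !gnorm. Qed.

Lemma conj_setM g h H : conj_set g (conj_set h H) = conj_set (g * h) H.
Proof.
by rewrite !conj_setE; apply/seteqP; split=> x /=; rewrite !gnorm.
Qed.

Lemma conj_setI g H K :
  conj_set g (H `&` K) = conj_set g H `&` conj_set g K.
Proof. by rewrite !conj_setE. Qed.

Lemma conj_set_id g : conj_set g [set 1] = [set 1].
Proof.
rewrite conj_setE; apply/seteqP; split=> x /= => [h|->]; last by rewrite !gnorm.
apply: (mulgI g^-1); apply: (mulIg g).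
by rewrite h !gnorm.
Qed.

Lemma conj_set_subgroup g H : subgroup H -> subgroup (conj_set g H).
Proof.
rewrite conj_setE => sH; apply/subgroupP; split=> /= [|x y Hx Hy].
  by rewrite !gnorm; exact: subgroup1.
have := subgroupM sH Hx (subgroupV sH Hy).
by rewrite !gnorm.
Qed.

Lemma normaliserP H g : normaliser H g <-> forall x, H (g * x * g^-1) = H x.
Proof.
rewrite /normaliser/= conj_setE; split=> [E x|E].
  by rewrite -{1}E /= !gnorm.
by apply/seteqP; split=> x /=; rewrite -(E (g^-1 * x * g)) !gnorm.
Qed.

Lemma normaliser_sub H : subgroup H -> H `<=` normaliser H.
Proof.
move=> sH g Hg; apply/normaliserP => x.
by rewrite subgroupMr ?subgroupMl//; exact: subgroupV.
Qed.

Lemma normaliser_subgroup H : subgroup (normaliser H).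
Proof.
apply/subgroupP; split; first by rewrite /normaliser/= conj_set1g.
move=> x y; rewrite /normaliser /= => Hx Hy.
have Hy' : conj_set y^-1 H = H by rewrite -{1}Hy conj_setM mulVg conj_set1g.
by rewrite -conj_setM Hy'.
Qed.

Lemma cvgM (T : Type) (F : set_system T) (f g : T -> G) (a b : G)
    {FF : Filter F} :
  f @ F --> a -> g @ F --> b -> (fun t => f t * g t) @ F --> a * b.
Proof.
move=> fa gb.
exact: (cvg_comp2 (h := fun x y : G => x * y) fa gb (@mulg_continuous G (a, b))).
Qed.

Lemma cvgV (T : Type) (F : set_system T) (f : T -> G) (a : G)
    {FF : Filter F} :
  f @ F --> a -> (fun t => (f t)^-1) @ F --> a^-1.
Proof. by move=> fa; exact: (cvg_comp _ _ fa (@invg_continuous G a)). Qed.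

Lemma near1_inv (P : G -> Prop) :
  (\forall x \near (1 : G), P x) -> \forall x \near (1 : G), P x^-1.
Proof.
move=> P1; have := cvgV (F := nbhs (1 : G)) (@cvg_id _ _) ; rewrite invg1.
exact.
Qed.

Lemma near_mulVg (P : G -> Prop) g :
  (\forall x \near (1 : G), P x) -> \forall x \near g, P (g^-1 * x).
Proof.
move=> P1; have := @cvgM _ (nbhs g) (fun=> g^-1) id g^-1 g _ (cvg_cst _) (@cvg_id _ _).
by rewrite mulVg; exact.
Qed.

Lemma near1_conj (P : G -> Prop) g :
  (\forall x \near (1 : G), P x) -> \forall x \near (1 : G), P (g * x * g^-1).
Proof.
move=> P1; have := @cvgM _ (nbhs (1 : G)) (fun x => g * x) (fun=> g^-1) (g * 1)
   g^-1 _ (cvgM (cvg_cst g) (@cvg_id _ _)) (cvg_cst _).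
by rewrite mulg1 mulgV; exact.
Qed.

Lemma near1_commg (P : G -> Prop) g :
  (\forall x \near (1 : G), P x) ->
  \forall x \near (1 : G), P (x^-1 * (g * x * g^-1)).
Proof.
move=> P1.
have c : (fun x : G => x^-1 * (g * x * g^-1)) @ (1 : G) --> 1^-1 * (g * 1 * g^-1).
  apply: cvgM; first exact: (cvgV (@cvg_id _ _)).
  by apply: cvgM; [apply: cvgM; [exact: cvg_cst|exact: cvg_id] | exact: cvg_cst].
by move: c; rewrite !gnorm; exact.
Qed.

Lemma subgroup_open H :
  subgroup H -> (\forall x \near (1 : G), H x) -> open H.
Proof.
move=> sH H1; rewrite openE => g Hg; rewrite /interior.
have := near_mulVg g H1; apply: filterS => x.
by rewrite subgroupMl//; exact: subgroupV.
Qed.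

Lemma open_near1 H : subgroup H -> open H -> \forall x \near (1 : G), H x.
Proof.
by move=> sH oH; apply: open_nbhs_nbhs; split=> //; exact: subgroup1.
Qed.

Lemma open_subgroup_closed H : subgroup H -> open H -> closed H.
Proof.
move=> sH oH g clH.
have := near_mulVg g (open_near1 sH oH) => /clH[x [Hx]] /=.
by rewrite subgroupMr// subgroupVE.
Qed.

Lemma conj_set_continuous g : continuous (fun x : G => g * x * g^-1).
Proof.
move=> x; apply: cvgM; [apply: cvgM; [exact: cvg_cst|exact: cvg_id] | exact: cvg_cst].
Qed.

Lemma conj_set_compact g K : compact K -> compact (conj_set g K).
Proof.
move=> cK; apply: (@continuous_compact _ _ (fun x => g * x * g^-1) K) => //.
exact/continuous_subspaceT/conj_set_continuous.
Qed.

Lemma conj_set_open g K : open K -> open (conj_set g K).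
Proof.
move=> oK; rewrite conj_setE.
have -> : [set x | K (g^-1 * x * g)] = (fun x => g^-1 * x * g^-1^-1) @^-1` K.
  by rewrite invgK.
by apply: open_comp => // x _; exact: conj_set_continuous.
Qed.

Lemma normaliser_conj g K :
  normaliser (conj_set g K) = conj_set g (normaliser K).
Proof.
rewrite [RHS]conj_setE /normaliser; apply/seteqP; split=> x /=.
  by rewrite -!conj_setM => ->; rewrite conj_setM mulVg conj_set1g.
move=> /(congr1 (conj_set g)); rewrite !conj_setM !mulgA mulgV mul1g.
by [].
Qed.

Lemma conj_set_locally_normal g K : locally_normal K -> locally_normal (conj_set g K).
Proof.
move=> [sK cK oN]; split; [exact: conj_set_subgroup|exact: conj_set_compact|].
by rewrite normaliser_conj; exact: conj_set_open.
Qed.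

Lemma compact_near1_conj K P :
  compact K -> (\forall x \near (1 : G), P x) ->
  \forall x \near (1 : G), forall k, K k -> P (k * x * k^-1).
Proof.
move=> /compact_near_coveringP cK P1.
apply: (cK _ (nbhs (1 : G)) (fun x k => P (k * x * k^-1))) => k Kk.
have : (fun z : G * G => z.1 * z.2 * z.1^-1) @ (k, (1 : G)) --> k * 1 * k^-1.
  by apply: cvgM; [apply: cvgM; [exact: cvg_fst|exact: cvg_snd]
                  |apply: cvgV; exact: cvg_fst].
rewrite mulg1 mulgV => /(_ _ P1).
by rewrite near_simpl.
Qed.

End GroupTopology.

(** * Compact open subgroups *)

Section HausdorffGroup.
Variable G : topologicalGroupType.
Hypothesis hausG : hausdorff_space G.
Implicit Types (g h x y : G) (A B C H K L U V W : set G).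

Let compact_closedG K : compact K -> closed K := compact_closed hausG.

(** The products [a^-1 * b] form a compact set that misses [1]. Hence [W] can be taken so small that
    the open sets [A W] and [B W] are disjoint. *)
Lemma compact_separated A B : compact A -> compact B -> A `&` B = set0 ->
  exists U V, [/\ open U, open V, A `<=` U, B `<=` V & U `&` V = set0].
Proof.
move=> cA cB AB0.
pose f (p : G * G) := p.1^-1 * p.2.
have cf : continuous f.
  move=> [a b]; suff : (fun z : G * G => z.1^-1 * z.2) @ (a, b) --> a^-1 * b by [].
  by apply: cvgM; [apply: cvgV; exact: cvg_fst|exact: cvg_snd].
have cfAB : compact (f @` (A `*` B)).
  apply: (@continuous_compact _ _ f); last exact: compact_setX.
  exact: continuous_subspaceT.
have near_notAB : \forall x \near (1 : G), ~ (f @` (A `*` B)) x.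
  have oN : open (~` (f @` (A `*` B))) by apply: closed_openC; exact: compact_closedG.
  apply: (open_nbhs_nbhs (conj oN _)).
  move=> [[a b] [/= Aa Bb]]; rewrite /f /= => ab1.
  have abE : a = b by rewrite -[b](mulKg a^-1) invgK ab1 mulg1.
  have : (A `&` B) a by split=> //; rewrite abE.
  by rewrite AB0.
have : \forall z \near ((1 : G), (1 : G)), ~ (f @` (A `*` B)) (z.1 * z.2^-1).
  have : (fun z : G * G => z.1 * z.2^-1) @ ((1 : G), (1 : G)) --> (1 : G) * 1^-1.
    by apply: cvgM; [exact: cvg_fst|apply: cvgV; exact: cvg_snd].
  by rewrite mulgV => /(_ _ near_notAB).
move=> [[N1 N2] /= [N11 N21] N12].
pose W := (N1 `&` N2)°.
have W1 : W 1 by apply: nbhs_singleton; apply: nbhs_interior; exact: filterI.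
have WN : W `<=` N1 `&` N2 := @interior_subset _ _.
pose M D := \bigcup_(a in D) ((fun x => a^-1 * x) @^-1` W).
have oM D : open (M D).
  apply: bigcup_open => a _; apply: open_comp; last exact: open_interior.
  by move=> x _; apply: cvgM; [exact: cvg_cst|exact: cvg_id].
have DM D : D `<=` M D by move=> x Dx; exists x => //=; rewrite mulVg.
exists (M A), (M B); split => //; rewrite -subset0 => x [[a Aa /WN[Wa _]] [b Bb /WN[_ Wb]]].
apply: (N12 (a^-1 * x, b^-1 * x)) => //=; exists (a, b) => //.
by rewrite /f /= !gnorm.
Qed.

(** [Q] is the quasi-component of [x] in the compact neighbourhood [K]. It is connected, hence
    reduced to [x], and compactness puts a relatively clopen [C] inside any given open set
    containing [Q]. *)
Lemma totally_disconnected_compact_open K (P : set G) x :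
  totally_disconnected [set: G] -> compact K -> nbhs x K -> nbhs x P ->
  exists C, [/\ open C, compact C, C x & C `<=` P].
Proof.
move=> tdG cK Kx Px.
have clK := compact_closedG cK.
pose F := [set C : set G | [/\ C `<=` K, closed C, closed (K `\` C) & C x]].
pose Q := \bigcap_(C in F) C.
have FK : F K.
  by split => //; [rewrite setDv; exact: closed0|exact: nbhs_singleton].
have Qsub C : F C -> Q `<=` C by move=> FC y; apply.
have clQ : closed Q by apply: closed_bigI => C [].
have cQ : compact Q by apply: (subclosed_compact clQ cK); exact: Qsub.
(* The complements of the members of [F] cover the part of [K] outside [O]; finitely many suffice,
   and [F] is stable under finite intersections. *)
have small O : open O -> Q `<=` O -> exists2 C, F C & C `<=` O.
  move=> oO QO.
  have cKO : compact (K `\` O).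
    by apply: compact_closedI => //; exact: open_closedC.
  have [|S [fS SF KS]] := compact_finite_subcover (D := F)
      (C := fun C => ~` C) cKO.
    move=> z [Kz nOz].
    have /existsNP[C /not_implyP[FC nCz]] : ~ Q z by move=> /QO.
    exists C => //; suff : \forall t \near z, (~` C) t.
      by apply: filterS => t ? _.
    apply: open_nbhs_nbhs; split => //; apply: closed_openC.
    by case: FC.
  exists (K `&` \bigcap_(C in S) C); last first.
    move=> y [Ky Sy]; apply: contrapT => nOy.
    by have [//|C SC] := KS y; apply; exact: Sy.
  split.
  - exact: subIsetl.
  - by apply: closedI => //; apply: closed_bigI => C /SF[].
  - have -> : K `\` (K `&` \bigcap_(C in S) C) = \bigcup_(C in S) (K `\` C).
      apply/seteqP; split=> y.
        move=> [Ky] /not_andP[//|/existsNP[C /not_implyP[SC nCy]]].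
        by exists C.
      by move=> [C SC [Ky nCy]]; split => // -[_ /(_ _ SC)].
    by apply: closed_bigcup => // C /SF[].
  - by split; [exact: nbhs_singleton|move=> C /SF[]].
have Qx : Q x by move=> C [].
have connQ : connected Q.
  move=> B [b Bb] [O oO BO] [D clD BD].
  have clB : closed B by rewrite BD; exact: closedI.
  have BQ : B `<=` Q by rewrite BD; exact: subIsetl.
  have cB : compact B by exact: (subclosed_compact clB cQ).
  have clQB : closed (Q `\` B).
    have -> : Q `\` B = Q `&` ~` O.
      rewrite BO; apply/seteqP; split=> y [Qy nBy]; split=> //.
        by move=> Oy; apply: nBy.
      by move=> [].
    by apply: closedI => //; exact: open_closedC.
  have cQB : compact (Q `\` B) by apply: (subclosed_compact clQB cQ) => y [].
  have [U [V [oU oV BU QBV UV0]]] := compact_separated cB cQB (setDIK _ _).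
  have [|C FC CUV] := small (U `|` V) (openU oU oV).
    by move=> y Qy; have [By|nBy] := pselect (B y); [left; exact: BU|right; exact: QBV].
  have [CK clC clKC Cx] := FC.
  have aux U' V' : open U' -> open V' -> C `<=` U' `|` V' -> U' `&` V' = set0 ->
      U' x -> Q `<=` U'.
    move=> oU' oV' CUV' UV0' U'x y Qy.
    suff : F (C `&` U') by move=> /Qsub/(_ _ Qy)[].
    split => //; first by move=> z [/CK].
    - have -> : C `&` U' = C `&` ~` V'.
        apply/seteqP; split=> z [Cz].
          by move=> U'z; split=> // V'z; have : (U' `&` V') z by []; rewrite UV0'.
        by move=> nV'z; split => //; case: (CUV' z Cz).
      by apply: closedI => //; exact: open_closedC.
    - have -> : K `\` (C `&` U') = (K `\` C) `|` (C `&` ~` U').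
        apply/seteqP; split=> z.
          move=> [Kz /not_andP nCU]; have [Cz|nCz] := pselect (C z); last by left.
          by right; split=> //; case: nCU.
        by move=> [[Kz nCz]|[Cz nUz]]; split=> //; [move=> []|exact: CK|move=> []].
      by apply: closedU => //; apply: closedI => //; exact: open_closedC.
  have [Ux|Vx] := CUV x Cx.
    have QU := aux U V oU oV CUV UV0 Ux.
    apply/seteqP; split=> // y Qy; apply: contrapT => nBy.
    have : (U `&` V) y by split; [exact: QU|exact: QBV].
    by rewrite UV0.
  have QV : Q `<=` V by apply: (aux V U) => //; [rewrite setUC|rewrite setIC].
  have : (U `&` V) b by split; [exact: BU|apply: QV; exact: BQ].
  by rewrite UV0.
have Q1 : Q `<=` [set x].
  by rewrite -(tdG x I) => y Qy; exists Q.
have [||C [CK clC clKC Cx] CO] := small (K° `&` P°).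
- by apply: openI; exact: open_interior.
- by move=> y /Q1 ->; split; apply: nbhs_singleton; exact: nbhs_interior.
exists C; split => //; last by move=> y /CO[_ /interior_subset].
  (* Relatively clopen in [K] and contained in the interior of [K], [C] is open in [G]. *)
  have -> : C = (K° `&` P°) `&` ~` (K `\` C).
    apply/seteqP; split=> y.
      by move=> Cy; split; [exact: CO|move=> []].
    by move=> [[/interior_subset Ky _] /not_andP[//|/contrapT]].
  apply: openI; last exact: closed_openC.
  by apply: openI; exact: open_interior.
exact: (subclosed_compact clC cK).
Qed.

Lemma open_subgroup_compact C U :
  compact C -> subgroup U -> open U -> U `<=` C -> compact_open_subgroup U.
Proof.
move=> cC sU oU UC; split => //.
by apply: (subclosed_compact _ cC UC); exact: open_subgroup_closed.
Qed.

(* In a compact open set [C] containing [1], the right stabiliser of [C] is an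
   open subgroup. *)
Lemma van_dantzig (P : set G) : locally_compact [set: G] ->
  totally_disconnected [set: G] -> nbhs (1 : G) P ->
  exists2 U, compact_open_subgroup U & U `<=` P.
Proof.
move=> lcG tdG P1.
have [K] := lcG 1 I; rewrite withinET => K1 [cK clK].
have [C [oC cC C1 CP]] := totally_disconnected_compact_open tdG cK K1 P1.
pose U : set G := [set h | forall c, C (c * h) = C c].
have UC : U `<=` C by move=> h /(_ 1); rewrite mul1g => ->.
have sU : subgroup U.
  apply/subgroupP; split=> [c|x y Ux Uy c]; first by rewrite mulg1.
  by rewrite mulgA -Uy mulgVK Ux.
have near_sub : \forall h \near (1 : G), forall c, C c -> C (c * h).
  move: (cC) => /compact_near_coveringP nC.
  apply: (nC _ (nbhs (1 : G)) (fun h c => C (c * h))) => c Cc.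
  have : (fun z : G * G => z.1 * z.2) @ (c, (1 : G)) --> c * 1.
    by apply: cvgM; [exact: cvg_fst|exact: cvg_snd].
  by rewrite mulg1 => /(_ C); rewrite near_simpl; apply; exact: open_nbhs_nbhs.
exists U; last exact: (subset_trans UC).
apply: (open_subgroup_compact cC) => //; apply: subgroup_open => //.
have := near1_inv near_sub; apply: filterS2 (near_sub) => h hC hVC c.
by apply/propext; split=> [/hVC|/hC//]; rewrite mulgK.
Qed.

(** [W] is the intersection of the [U]-conjugates of a small [V]; it remains a neighbourhood of [1]
    because [U] is compact. *)
Lemma open_normal_core U (P : set G) : compact_open_subgroup U -> nbhs (1 : G) P ->
  locally_compact [set: G] -> totally_disconnected [set: G] ->
  exists W, [/\ compact_open_subgroup W, W `<=` P, W `<=` U & U `<=` normaliser W].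
Proof.
move=> [sU cU oU] P1 lcG tdG.
have [|V [sV cV oV] VPU] := van_dantzig lcG tdG (P := P `&` U).
  by apply: filterI => //; exact: open_near1.
pose W := [set x | forall u, U u -> V (u * x * u^-1)].
have WV : W `<=` V.
  by move=> x /(_ 1 (subgroup1 sU)); rewrite !gnorm.
have sW : subgroup W.
  apply/subgroupP; split=> [u Uu|x y Wx Wy u Uu].
    by rewrite !gnorm; exact: subgroup1.
  have := subgroupM sV (Wx u Uu) (subgroupV sV (Wy u Uu)).
  by rewrite !gnorm.
exists W; split.
- apply: (open_subgroup_compact cV) => //; apply: subgroup_open => //.
  by apply: compact_near1_conj => //; exact: open_near1.
- by move=> x /WV/VPU[].
- by move=> x /WV/VPU[].
- move=> u Uu; apply/normaliserP => x; apply/propext; split=> Wx v Uv.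
    have := Wx (v * u^-1) (subgroupM sU Uv (subgroupV sU Uu)).
    by rewrite !gnorm.
  by have := Wx (v * u) (subgroupM sU Uv Uu); rewrite !gnorm.
Qed.

(** The left cosets of the intersection are relatively open in [K], so by compactness there are
    finitely many. *)
Lemma near1_finite_index K L : compact K -> subgroup K -> subgroup L ->
  (\forall x \near (1 : G), K x -> L x) -> finite_index K (K `&` L).
Proof.
move=> cK sK sL KL.
pose f x := [set x * h | h in K `&` L].
have [|S [fS _ KS]] := compact_finite_subcover (D := setT)
    (C := fun (y : set G) => [set x | f x = y]) cK.
  move=> x Kx; exists (f x) => //.
  have := near_mulVg x KL; apply: filterS => z KLz Kz /=.
  have [Kxz Lxz] : (K `&` L) (x^-1 * z).
    have Kxz : K (x^-1 * z) by apply: subgroupM => //; exact: subgroupV.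
    by split=> //; exact: KLz.
  apply/seteqP; split=> _ [h [Kh Lh] <-].
    exists (x^-1 * z * h); last by rewrite !gnorm.
    by split; exact: subgroupM.
  exists ((x^-1 * z)^-1 * h); last by rewrite !gnorm.
  by split; apply: subgroupM => //; exact: subgroupV.
by apply: sub_finite_set fS => _ [x Kx <-]; have [y Sy /= fxy] := KS x Kx; rewrite -/(f x) fxy.
Qed.

(** The cosets not containing [1] are closed and finite in number, so their union stays away from
    [1]. *)
Lemma finite_index_near1 K L : compact K -> compact L -> subgroup K ->
  subgroup L -> finite_index K (K `&` L) ->
  \forall x \near (1 : G), K x -> L x.
Proof.
move=> cK cL sK sL fKL.
have sKL := subgroupI sK sL.
pose S := [set C | (exists2 x, K x & [set x * h | h in K `&` L] = C) /\ ~ C 1].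
have fS : finite_set S by apply: sub_finite_set fKL => _ [[x Kx <-] _]; exists x.
have clS : closed (\bigcup_(C in S) C).
  apply: closed_bigcup => // _ [[x _ <-] _]; apply: compact_closedG.
  apply: (@continuous_compact _ _ (fun h => x * h)).
    apply: continuous_subspaceT => y.
    by apply: cvgM; [exact: cvg_cst|exact: cvg_id].
  by apply: compact_closedI => //; exact: compact_closedG.
have : \forall x \near (1 : G), (~` \bigcup_(C in S) C) x.
  by apply: open_nbhs_nbhs; split; [exact: closed_openC|move=> [C []]].
apply: filterS => x nSx Kx; apply: contrapT => nLx; apply: nSx.
exists [set x * h | h in K `&` L].
  split; first by exists x.
  move=> [h [Kh Lh] xh1]; apply: nLx.
  by rewrite -(mulgK h x) xh1 mul1g; exact: subgroupV.
by exists 1; [exact: subgroup1|rewrite mulg1].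
Qed.

End HausdorffGroup.

(** * Centralisers of germs *)

Lemma near_finite (T : Type) (I : choiceType) (C : set I) (F : set_system T)
    (P : I -> T -> Prop) {FF : Filter F} :
  finite_set C -> (forall i, C i -> \forall t \near F, P i t) ->
  \forall t \near F, forall i, C i -> P i t.
Proof.
move=> /finite_fsetP[D ->] CP.
have := @filter_bigI T I D P F FF (fun i iD => CP i iD).
by apply: filterS => t Pt i Di; exact: Pt.
Qed.

Section Centralisers.
Variable G : topologicalGroupType.
Implicit Types (g h x y : G) (H K L U V W : set G).

Definition centr K : set G := [set x | forall k, K k -> x * k = k * x].

Lemma centraliserE U K : centraliser U K = U `&` centr K.
Proof. by []. Qed.

Lemma centr_subgroup K : subgroup (centr K).
Proof.
apply/subgroupP; split=> [k _|x y Kx Ky k Kk]; first by rewrite !gnorm.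
by apply/commute_sym/commuteM; last apply: commuteV;
  apply/commute_sym; [exact: Kx|exact: Ky].
Qed.

Lemma centr_closed K : hausdorff_space G -> closed (centr K).
Proof.
move=> hausG.
have -> : centr K =
    \bigcap_(k in K) ((fun x => x * k * x^-1) @^-1` [set k]).
  apply/seteqP; split=> x /= Kx k Kk.
    by rewrite /= Kx// mulgK.
  by have /(congr1 (fun z => z * x)) := Kx k Kk; rewrite mulgVK.
apply: closed_bigI => k _; apply: preimage_closed.
  by move=> x _; apply: cvgM; [apply: cvgM; [exact: cvg_id|exact: cvg_cst]
                              |apply: cvgV; exact: cvg_id].
exact/accessible_closed_set1/hausdorff_accessible.
Qed.

Lemma centr_conj g K x : centr (conj_set g K) (g * x * g^-1) = centr K x.
Proof.
rewrite conj_setE; apply/propext; split=> Kx k Kk /=.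
  have := Kx (g * k * g^-1); rewrite /= !gnorm => /(_ Kk) h.
  by apply: (mulgI g); apply: (mulIg g^-1); rewrite !gnorm.
have /(congr1 (fun z => g * z * g^-1)) := Kx (g^-1 * k * g) Kk.
by rewrite !gnorm.
Qed.

(** On locally normal subgroups this is the order of the structure lattice ([LN_leP]). Arbitrary
    sets are allowed so that it also applies to [germ_centr K], which need not be compact. *)
Definition germ_le K L := \forall x \near (1 : G), K x -> L x.

(* For [K] locally normal, [perp (comm_class K)] consists of the locally normal
   subgroups which agree near [1] with [germ_centr K]. *)
Definition germ_centr K : set G :=
  [set x | \forall y \near (1 : G), K y -> x * y = y * x].

Lemma centr_germ_centr K : centr K `<=` germ_centr K.
Proof. by move=> x Kx; near=> y; exact: Kx. Unshelve. all: by end_near. Qed.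

Lemma germ_centr_subgroup K : subgroup (germ_centr K).
Proof.
apply/subgroupP; split=> [|x y Kx Ky].
  by near=> k; rewrite !gnorm.
apply: filterS2 Kx Ky => k Kx Ky Kk.
by apply/commute_sym/commuteM; last apply: commuteV;
  apply/commute_sym; [exact: Kx|exact: Ky].
Unshelve. all: by end_near. Qed.

Lemma germ_centr_conj g K x :
  germ_centr (conj_set g K) (g * x * g^-1) = germ_centr K x.
Proof.
rewrite conj_setE /germ_centr /=; apply/propext; split=> Kx.
  have := near1_conj g Kx; apply: filterS => k /= h Kk.
  apply: (mulgI g); apply: (mulIg g^-1); move: h; rewrite !gnorm.
  exact.
have := near1_conj g^-1 Kx; apply: filterS => k /=; rewrite invgK => h Kk.
by have /(congr1 (fun z => g * z * g^-1)) := h Kk; rewrite !gnorm.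
Qed.

Lemma germ_centr_conjE g K :
  germ_centr (conj_set g K) = conj_set g (germ_centr K).
Proof.
rewrite [RHS]conj_setE; apply/seteqP; split=> x /=;
  by rewrite -(germ_centr_conj g K (g^-1 * x * g)) !gnorm.
Qed.

Lemma normaliser_germ_centr K : normaliser K `<=` normaliser (germ_centr K).
Proof.
move=> g gK; rewrite /normaliser /= -germ_centr_conjE.
by move: gK; rewrite /normaliser /= => ->.
Qed.

End Centralisers.

(** * Topological simplicity, finite generation and the quasi-centre *)

Section Generation.
Variable G : topologicalGroupType.
Hypothesis hG : class_S G.
Implicit Types (g h x y : G) (A B C H K L U V W X : set G).

Let hausG : hausdorff_space G. Proof. by case: hG => -[]. Qed.
Let lcG : locally_compact [set: G]. Proof. by case: hG => -[]. Qed.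
Let tdG : totally_disconnected [set: G]. Proof. by case: hG. Qed.

Lemma small_subgroup (P : set G) : nbhs (1 : G) P ->
  exists2 U, compact_open_subgroup U & U `<=` P.
Proof. exact: van_dantzig. Qed.

Lemma small_normal_subgroup U (P : set G) : compact_open_subgroup U ->
  nbhs (1 : G) P ->
  exists W, [/\ compact_open_subgroup W, W `<=` P, W `<=` U & U `<=` normaliser W].
Proof. by move=> cU P1; exact: open_normal_core. Qed.

Lemma near1_nontrivial (P : set G) : nbhs (1 : G) P -> exists2 x, P x & x <> 1.
Proof.
move=> P1; apply: contrapT => nP.
have {}P1 : \forall x \near (1 : G), x = 1.
  apply: filterS P1 => x Px; apply: contrapT => x1; apply: nP.
  by exists x.
case: hG => _ _ _; apply => A; rewrite openE => g Ag.
have := near_mulVg g P1; apply: filterS => x /= gx1.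
by rewrite -[x](mulVKg g) gx1 mulg1.
Qed.

Lemma nontrivial_group : exists g : G, g <> 1.
Proof. by have [x _] := near1_nontrivial (@filterT _ (nbhs (1 : G)) _); exists x. Qed.

Lemma near1_neq g : g <> 1 -> \forall x \near (1 : G), x <> g.
Proof.
move=> g1; have cl := @accessible_closed_set1 _ (hausdorff_accessible hausG) g.
by apply: (open_nbhs_nbhs (conj (closed_openC cl) _)) => /= g1'; apply: g1.
Qed.

Lemma closed_normal_full H : closed H -> normaliser H = setT -> subgroup H ->
  (exists2 x, H x & x <> 1) -> H = setT.
Proof.
move=> clH nH sH [x Hx x1]; case: hG => _ _ [_ simG] _.
have [|H1|//] := simG H clH; first by split; rewrite ?nH.
by move: Hx; rewrite H1.
Qed.

Lemma closure_subgroup H : subgroup H -> subgroup (closure H).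
Proof.
move=> sH; apply/subgroupP; split.
  by apply: subset_closure; exact: subgroup1.
move=> x y clx cly P Pxy.
have : (fun z : G * G => z.1 * z.2^-1) @ (x, y) --> x * y^-1.
  by apply: cvgM; [exact: cvg_fst|apply: cvgV; exact: cvg_snd].
move=> /(_ _ Pxy) [[N M] /= [Nx My] NMP].
have [a [Ha Na]] := clx _ Nx; have [b [Hb Mb]] := cly _ My.
exists (a * b^-1); split; last exact: (NMP (a, b)).
by apply: subgroupM => //; exact: subgroupV.
Qed.

Lemma closure_conj g H x : closure H x -> closure (conj_set g H) (g * x * g^-1).
Proof.
move=> clx P Pgx; have /clx[y [Hy Py]] := conj_set_continuous Pgx.
by exists (g * y * g^-1); split => //; exists y.
Qed.

Lemma smallest_subgroup (P : set G) : subgroup (smallest (@subgroup G) P).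
Proof.
apply/subgroupP; split; first by move=> H [/subgroup1].
move=> x y Px Py H [sH PH].
by apply: subgroupM => //; [exact: Px|apply: subgroupV => //; exact: Py].
Qed.

(** [P] generates a normal subgroup, dense by topological simplicity. A dense subgroup meets every
    translate of the neighbourhood [U], so every [g] is a product of elements of [H]. *)
Lemma normal_closure_dense (P : set G) U H :
  (forall g x, P x -> P (g * x * g^-1)) -> (exists2 x, P x & x <> 1) ->
  (\forall x \near (1 : G), U x) -> subgroup H -> U `<=` H -> P `<=` H ->
  H = setT.
Proof.
move=> Pconj [p Pp p1] U1 sH UH PH.
pose N := smallest (@subgroup G) P.
have PN : P `<=` N by exact: sub_gen_smallest.
have sN : subgroup N := smallest_subgroup P.
have NH : N `<=` H by exact: smallest_sub.
have Nconj g x : N x -> N (g * x * g^-1).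
  move=> Nx; have : smallest (@subgroup G) P `<=` conj_set g^-1 N.
    apply: smallest_sub; first exact: conj_set_subgroup.
    by move=> z Pz; rewrite conj_setE /= invgK; apply: PN; exact: Pconj.
  by move=> /(_ _ Nx); rewrite conj_setE /= invgK.
have nN : forall g, conj_set g N = N.
  move=> g; rewrite conj_setE; apply/seteqP; split=> x /= Nx.
    by have := Nconj g _ Nx; rewrite !gnorm.
  by have := Nconj g^-1 _ Nx; rewrite !gnorm.
have clN : closure N = setT.
  apply: closed_normal_full.
  - exact: closed_closure.
  - apply/seteqP; split=> // g _; apply/normaliserP => x.
    apply/propext; split=> [/(@closure_conj g^-1 N _)|/(@closure_conj g N _)]; rewrite nN//.
    by rewrite !gnorm.
  - exact: closure_subgroup.
  - by exists p => //; apply: subset_closure; exact: PN.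
apply/seteqP; split=> // g _.
have : closure N g by rewrite clN.
have U1' : \forall x \near g, U (g^-1 * x) := near_mulVg g U1.
move=> /(_ _ U1')[x [Nx Ugx]].
have -> : g = x * (g^-1 * x)^-1 by rewrite !gnorm.
by apply: subgroupM => //; [exact: NH|apply: subgroupV => //; exact: UH].
Qed.

(** By [normal_closure_dense], the subgroups generated by [U] and a finite part of [P] have union
    [G]. They are open, so finitely many of them cover a compact generating set. *)
Lemma finite_generation (P : set G) U :
  (forall g x, P x -> P (g * x * g^-1)) -> (exists2 x, P x & x <> 1) ->
  compact_open_subgroup U ->
  exists C, [/\ finite_set C, C `<=` P &
    forall H, subgroup H -> U `<=` H -> C `<=` H -> H = setT].
Proof.
move=> Pconj P1 [sU cU oU].
have U1 := open_near1 sU oU.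
case: hG => -[_ _ [K0 cK0 genK0]] _ _ _.
pose D := [set C : set G | finite_set C /\ C `<=` P].
pose Hc C := smallest (@subgroup G) (U `|` C).
have sHc C : subgroup (Hc C) by exact: smallest_subgroup.
have UHc C : U `|` C `<=` Hc C by exact: sub_gen_smallest.
have HcS C C' : C `<=` C' -> Hc C `<=` Hc C'.
  move=> CC'; apply: smallest_sub => //.
  by move=> x [Ux|/CC' Cx]; apply: UHc; [left|right].
have HP : \bigcup_(C in D) Hc C = setT.
  apply: (normal_closure_dense Pconj P1 U1).
  - apply/subgroupP; split=> [|x y [C [fC CP] Cx] [C' [fC' CP'] C'y]].
      by exists set0; [split; [exact: finite_set0|exact: sub0set]|exact: subgroup1].
    exists (C `|` C'); first by split; [rewrite finite_setU|rewrite subUset].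
    apply: (subgroupM (sHc _)); first exact: (HcS C _ (@subsetUl _ C C') _ Cx).
    by apply: (subgroupV (sHc _)); exact: (HcS C' _ (@subsetUr _ C C') _ C'y).
  - move=> x Ux; exists set0; last by apply: UHc; left.
    by split; [exact: finite_set0|exact: sub0set].
  - move=> x Px; exists [set x]; last by apply: UHc; right.
    by split; [exact: finite_set1|move=> _ ->].
have [|S [fS SD KS]] := compact_finite_subcover (D := D) (C := Hc) cK0.
  move=> x _; have : (\bigcup_(C in D) Hc C) x by rewrite HP.
  move=> [C DC Cx]; exists C => //.
  have := near_mulVg x U1; apply: filterS => z Uz _.
  rewrite -[z](mulVKg x); apply: (subgroupM (sHc C) Cx).
  by apply: UHc; left.
exists (\bigcup_(C in S) C); split.
- by apply: bigcup_finite => // C /SD[].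
- by move=> x [C /SD[_ CP] /CP].
- move=> H sH UH CH; apply/seteqP; split=> // g _.
  have : smallest (@subgroup G) K0 g by rewrite genK0.
  apply: smallest_sub => // x /KS[C SC]; apply: smallest_sub => //.
  by rewrite subUset; split => // z Cz; apply: CH; exists C.
Qed.

(* Otherwise [G] is generated by [U] and a finite [C] of elements of
   [germ_centr X]. The elements of a small [W], normal in [U], which commute with
   all [U]-conjugates of [C] then form a proper closed subgroup normalised by [U]
   and centralised by [C]; it is nontrivial, as it contains [X] near [1]. *)
Lemma germ_centr_trivial X U :
  (forall P : set G, nbhs (1 : G) P -> exists x, [/\ X x, P x & x <> 1]) ->
  compact_open_subgroup U ->
  (forall u x, U u -> X x -> X (u * x * u^-1)) ->
  normaliser (germ_centr X) = setT ->
  germ_centr X `<=` [set 1].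
Proof.
move=> X1 cU Uconj nX q Xq; apply: contrapT => /= q1.
have Xconj g x : germ_centr X x -> germ_centr X (g * x * g^-1).
  have : normaliser (germ_centr X) g by rewrite nX.
  by move=> /normaliserP ->.
have [C [fC CX genC]] := finite_generation Xconj (ex_intro2 _ _ q Xq q1) cU.
have XC : \forall y \near (1 : G), forall c, C c -> X y -> c * y = y * c.
  by apply: near_finite => // c /CX.
have [g1 g11] := nontrivial_group.
(* Excluding [g1] from [W] ensures that [D] is not all of [G]. *)
have [|W [[sW cW oW] WP WU UW]] := small_normal_subgroup cU
    (P := [set y | (forall c, C c -> X y -> c * y = y * c) /\ y <> g1]).
  by apply: filterI => //; exact: near1_neq.
have [sU _ _] := cU.
pose E := [set u * c * u^-1 | u in U & c in C].
pose D := W `&` centr E.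
have sD : subgroup D by apply: subgroupI => //; exact: centr_subgroup.
have clD : closed D.
  by apply: closedI; [exact: compact_closed|exact: centr_closed].
have nD : normaliser D = setT.
  apply: genC; first exact: normaliser_subgroup.
  - have UD u x : U u -> D x -> D (u * x * u^-1).
      move=> Uu [Wx Ex]; split; first by have /normaliserP -> := UW u Uu.
      move=> _ [v Uv [c Cc <-]].
      have vE : E (u^-1 * v * c * (u^-1 * v)^-1).
        exists (u^-1 * v); first by apply: subgroupM => //; exact: subgroupV.
        by exists c.
      have /(congr1 (fun z => u * z * u^-1)) := Ex _ vE.
      by rewrite !gnorm.
    move=> u Uu; apply/normaliserP => x; apply/propext; split; last exact: UD.
    by move=> /(UD u^-1 _ (subgroupV sU Uu)); rewrite !gnorm.
  - move=> c Cc; apply/normaliserP => x; apply/propext.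
    have Ec : E c by exists 1; [exact: subgroup1|exists c => //; rewrite !gnorm].
    split=> [Dcx|Dx].
      have /(congr1 (fun z => c^-1 * z)) := Dcx.2 _ Ec; rewrite !gnorm => h.
      by have := Dcx; rewrite h !gnorm.
    by have := Dx.2 _ Ec => <-; rewrite mulgK.
have DT : D = setT.
  apply: closed_normal_full => //.
  have [x [Xx Wx x1]] := X1 W (open_near1 sW oW).
  exists x => //; split=> // _ [u Uu [c Cc <-]].
  have Wux : W (u^-1 * x * u^-1^-1).
    by have /normaliserP -> := UW _ (subgroupV sU Uu).
  have [/(_ c Cc) + _] := WP _ Wux.
  move=> /(_ (Uconj _ _ (subgroupV sU Uu) Xx)) /(congr1 (fun z => u * z * u^-1)).
  by rewrite !gnorm.
have : D g1 by rewrite DT.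
by move=> [/WP[_]].
Qed.

(** [germ_centr setT] is the quasi-centre, the set of elements with open centraliser. *)
Lemma quasi_centre_trivial x : germ_centr setT x -> x = 1.
Proof.
have [U cU _] := small_subgroup (@filterT _ (nbhs (1 : G)) _).
move=> /(@germ_centr_trivial setT U); apply => //.
- by move=> P /near1_nontrivial[y]; exists y.
- apply/seteqP; split=> // g _; apply: normaliser_germ_centr.
  by apply/normaliserP.
Qed.

Lemma locally_normal_near1 K : locally_normal K ->
  \forall x \near (1 : G), normaliser K x.
Proof.
by move=> [_ _ oN]; apply: open_near1 => //; exact: normaliser_subgroup.
Qed.

(** If [K] is discrete, then for [k] in [K] and [y] near [1] the commutator of [y] and [k] lies in
    [K] and near [1], hence is trivial. So [K] lies in the quasi-centre. *)
Lemma germ_trivial K : locally_normal K -> (\forall x \near (1 : G), K x -> x = 1) ->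
  K `<=` [set 1].
Proof.
move=> lK K1 k Kk; apply: quasi_centre_trivial.
have [sK _ _] := lK.
have := near1_commg k^-1 K1; rewrite invgK.
have := locally_normal_near1 lK; apply: filterS2 => y nKy Ky _.
have nKy' : normaliser K y^-1 by apply: subgroupV => //; exact: normaliser_subgroup.
have : K (y^-1 * (k^-1 * y * k)).
  rewrite !mulgA; apply: subgroupM => //.
  have /normaliserP := nKy'; rewrite invgK => ->.
  exact: subgroupV.
move=> /Ky /(congr1 (fun z => k * y * z)); rewrite !gnorm.
by move=> ->.
Qed.

Lemma near1_locally_normal K (P : set G) : locally_normal K ->
  (exists2 k, K k & k <> 1) -> nbhs (1 : G) P -> exists x, [/\ K x, P x & x <> 1].
Proof.
move=> lK [k Kk k1] P1; apply: contrapT => nP; apply: k1.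
apply: (germ_trivial lK) => //; apply: filterS P1 => x Px Kx.
by apply: contrapT => x1; apply: nP; exists x.
Qed.

(** As the normaliser is open, the conjugate of [K] by [u] is locally constant in [u]. *)
Lemma finite_conjugates K U : locally_normal K -> compact U ->
  finite_set [set conj_set u K | u in U].
Proof.
move=> lK cU.
have [|S [fS _ US]] := compact_finite_subcover (D := setT)
    (C := fun (y : set G) => [set u | conj_set u K = y]) cU.
  move=> u Uu; exists (conj_set u K) => //.
  have := near_mulVg u (locally_normal_near1 lK); apply: filterS => v nv _ /=.
  by rewrite -[v](mulVKg u) -conj_setM nv.
by apply: sub_finite_set fS => _ [u Uu <-]; have [y Sy /= ->] := US u Uu.
Qed.

(* The union [X] of finitely many conjugates of [K] that generate [G] together
   with [U] works: if [A] is one of them, [a] lies in [A] and [y] is near [1], then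
   [a^-1 y a] is the product of [y] by an element of [A] near [1], so that [A]
   normalises [germ_centr X]. *)
Lemma finite_conjugates_centr K : locally_normal K -> (exists2 k, K k & k <> 1) ->
  exists S : set (set G), [/\ finite_set S,
    (forall A, S A -> exists g, A = conj_set g K) &
    forall x, (forall A, S A -> germ_centr A x) -> x = 1].
Proof.
move=> lK [k Kk k1].
pose P := [set x | exists g, conj_set g K x].
have Pconj g x : P x -> P (g * x * g^-1).
  move=> [h hx]; exists (g * h); rewrite -conj_setM.
  by rewrite conj_setE /= !gnorm.
have Pk : P k by exists 1; rewrite conj_set1g.
have [U cU _] := small_subgroup (@filterT _ (nbhs (1 : G)) _).
have [sU cpU _] := cU.
have [C0 [fC0 C0P genC0]] := finite_generation Pconj (ex_intro2 _ _ k Pk k1) cU.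
(* [C0] alone could be empty; adding [k] guarantees that [X] has nontrivial elements near [1]. *)
pose C := C0 `|` [set k].
have fC : finite_set C by rewrite finite_setU.
have CP : C `<=` P by move=> x [/C0P|->].
have [f fP] : {f : G -> G & forall x, P x -> conj_set (f x) K x}.
  apply: (choice (P := fun x g => P x -> conj_set g K x)) => x.
  by have [[g gx]|nP] := pselect (P x); [exists g|exists 1].
pose A c := conj_set (f c) K.
have lA c : locally_normal (A c) by exact: conj_set_locally_normal.
(* Adding all [U]-conjugates makes [X] stable under [U] and keeps the family finite. *)
pose S := \bigcup_(c in C) [set conj_set u (A c) | u in U].
have fS : finite_set S.
  by apply: bigcup_finite => // c _; exact: finite_conjugates.
have SE B : S B -> exists g, B = conj_set g K.
  by move=> [c _ [u _ <-]]; exists (u * f c); rewrite /A conj_setM.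
exists S; split => // x Sx.
pose X := \bigcup_(B in S) B.
have SX B y : S B -> B y -> X y by move=> SB By; exists B.
have SA c : C c -> S (A c).
  by move=> Cc; exists c => //; exists 1; [exact: subgroup1|rewrite conj_set1g].
have Uconj u y : U u -> X y -> X (u * y * u^-1).
  move=> Uu [_ [c Cc [v Uv <-]] vy]; apply: (SX (conj_set (u * v) (A c))).
    by exists c => //; exists (u * v) => //; exact: subgroupM.
  by rewrite -conj_setM conj_setE /= !gnorm.
apply: (@germ_centr_trivial X U) => //.
- move=> Q Q1.
  have Ck : C k by right.
  have [|y [Ay Qy y1]] := near1_locally_normal (lA k) _ Q1.
    by exists k => //; exact: fP.
  by exists y; split=> //; apply: SX Ay; exact: SA.
- apply: genC0; first exact: normaliser_subgroup.
    move=> u Uu; apply: normaliser_germ_centr; apply/normaliserP => y.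
    apply/propext; split; last exact: Uconj.
    by move=> /(Uconj u^-1 _ (subgroupV sU Uu)); rewrite !gnorm.
  move=> c C0c; have Cc : C c by left.
  have Ac : A c c by apply: fP; exact: CP.
  have [sA _ _] := lA c.
  have aconj a y : A c a -> germ_centr X y -> germ_centr X (a * y * a^-1).
    move=> Aa Xy; rewrite /germ_centr /=.
    have := near1_commg a^-1 Xy; rewrite invgK.
    apply: filterS3 (locally_normal_near1 (lA c)) Xy => z nz yz yaz Xz.
    have Az : A c (z^-1 * (a^-1 * z * a)).
      rewrite !mulgA; apply: subgroupM => //.
      have nz' : normaliser (A c) z^-1 by apply: subgroupV => //; exact: normaliser_subgroup.
      have /normaliserP := nz'; rewrite invgK => ->.
      exact: subgroupV.
    have h1 := yz Xz; have h2 := yaz (SX _ _ (SA c Cc) Az).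
    have h3 : y * (a^-1 * z * a) = (a^-1 * z * a) * y.
      have -> : a^-1 * z * a = z * (z^-1 * (a^-1 * z * a)) by rewrite !gnorm.
      by rewrite mulgA h1 -[_ * _ * (_ * _)]mulgA h2 !mulgA.
    have /(congr1 (fun t => a * t * a^-1)) := h3.
    by rewrite !gnorm.
  apply/normaliserP => y; apply/propext; split; last exact: aconj.
  by move=> /(aconj c^-1 _ (subgroupV sA Ac)); rewrite !gnorm.
- rewrite /germ_centr /=.
  have : \forall y \near (1 : G), forall B, S B -> B y -> x * y = y * x.
    by apply: near_finite => // B /Sx.
  by apply: filterS => y h [B SB By]; exact: (h B).
Qed.

End Generation.

(** * The order on germs *)

Section GermOrder.
Variable G : topologicalGroupType.
Implicit Types (g h x y : G) (A B C H K L M N U V W X : set G).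

Lemma germ_le_refl K : germ_le K K.
Proof. by rewrite /germ_le; near=> x. Unshelve. all: by end_near. Qed.

Lemma germ_le_trans L K M : germ_le K L -> germ_le L M -> germ_le K M.
Proof. by rewrite /germ_le; apply: filterS2 => x KL LM /KL. Qed.

Lemma germ_leI K L M : germ_le M K -> germ_le M L -> germ_le M (K `&` L).
Proof.
by rewrite /germ_le; apply: filterS2 => x MK ML Mx; split; [exact: MK|exact: ML].
Qed.

Lemma sub_germ_le K L : K `<=` L -> germ_le K L.
Proof. by move=> KL; rewrite /germ_le; near=> x; exact: KL. Unshelve. all: by end_near. Qed.

Lemma near_germ_le K L : (\forall x \near (1 : G), L x) -> germ_le K L.
Proof. by rewrite /germ_le; apply: filterS => x. Qed.

Lemma germ_le_conj g K L : germ_le K L -> germ_le (conj_set g K) (conj_set g L).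
Proof.
by rewrite /germ_le !conj_setE => /(near1_conj g^-1); apply: filterS => x; rewrite invgK.
Qed.

Lemma germ_centrS K L : germ_le K L -> germ_centr L `<=` germ_centr K.
Proof.
by rewrite /germ_le => KL x; apply: filterS2 KL => y KLy Lx /KLy.
Qed.

Lemma germ_centr_eq K L : germ_le K L -> germ_le L K ->
  germ_centr K = germ_centr L.
Proof. by move=> KL LK; apply/seteqP; split; exact: germ_centrS. Qed.

Lemma normaliserI K L : normaliser K `&` normaliser L `<=` normaliser (K `&` L).
Proof. by move=> g [Kg Lg]; rewrite /normaliser /= conj_setI Kg Lg. Qed.

Lemma normaliser_centr K : normaliser K `<=` normaliser (centr K).
Proof.
move=> g nK; apply/normaliserP => x.
by rewrite -{1}(nK : conj_set g K = K) centr_conj.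
Qed.

Lemma normaliserV K g : normaliser K g -> normaliser K g^-1.
Proof. by apply: subgroupV; exact: normaliser_subgroup. Qed.

End GermOrder.

(** * Germs of locally normal subgroups *)

Section Germs.
Variable G : topologicalGroupType.
Hypothesis hG : class_S G.
Implicit Types (g h x y : G) (A B C H K L M N U V W X : set G).

Let hausG : hausdorff_space G. Proof. by case: hG => -[]. Qed.

Lemma locally_normalP K : subgroup K -> compact K ->
  (\forall x \near (1 : G), normaliser K x) -> locally_normal K.
Proof.
by move=> sK cK nK; split => //; apply: subgroup_open => //; exact: normaliser_subgroup.
Qed.

Lemma compact_open_near1 U : compact_open_subgroup U -> \forall x \near (1 : G), U x.
Proof. by move=> [sU _ oU]; exact: open_near1. Qed.

Lemma locally_normal_normalised K U : subgroup K -> compact K ->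
  compact_open_subgroup U -> U `<=` normaliser K -> locally_normal K.
Proof.
move=> sK cK /compact_open_near1 U1 UK; apply: locally_normalP => //.
by apply: filterS U1 => x /UK.
Qed.

Lemma compact_open_locally_normal U : compact_open_subgroup U -> locally_normal U.
Proof.
move=> cU; have [sU cpU _] := cU.
exact: (locally_normal_normalised _ _ cU (normaliser_sub sU)).
Qed.

Lemma locally_normal1 : locally_normal [set (1 : G)].
Proof.
apply: locally_normalP; first exact: subgroup_set1.
  exact: compact_set1.
by near=> x; rewrite /normaliser /= conj_set_id.
Unshelve. all: by end_near. Qed.

Lemma locally_normalI K L : locally_normal K -> locally_normal L ->
  locally_normal (K `&` L).
Proof.
move=> lK lL; have [sK cK _] := lK; have [sL cL _] := lL.
apply: locally_normalP; first exact: subgroupI.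
  by apply: compact_closedI => //; exact: compact_closed.
apply: filterS2 (locally_normal_near1 lK) (locally_normal_near1 lL) => x Kx Lx.
exact: normaliserI.
Qed.

Lemma locally_normal_centr U K : compact_open_subgroup U -> U `<=` normaliser K ->
  locally_normal (U `&` centr K).
Proof.
move=> cU UK; have [sU cpU _] := cU.
apply: (locally_normal_normalised _ _ cU).
- by apply: subgroupI => //; exact: centr_subgroup.
- by apply: compact_closedI => //; exact: centr_closed.
- move=> u Uu; apply: normaliserI; split; first exact: normaliser_sub.
  by apply: normaliser_centr; exact: UK.
Qed.

Lemma small_normalising K (P : set G) : locally_normal K -> nbhs (1 : G) P ->
  exists U, [/\ compact_open_subgroup U, U `<=` P & U `<=` normaliser K].
Proof.
move=> lK P1.
have [|U cU UP] := small_subgroup hG (P := P `&` normaliser K).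
  by apply: filterI => //; exact: locally_normal_near1.
by exists U; split => // x /UP[].
Qed.

Lemma nontrivialP K : ~ K `<=` [set 1] -> exists2 k, K k & k <> 1.
Proof. by move=> /existsNP[k /not_implyP[Kk k1]]; exists k. Qed.

Lemma locally_normal_germI K U : locally_normal K -> compact_open_subgroup U ->
  ~ K `<=` [set 1] -> ~ K `&` U `<=` [set 1].
Proof.
move=> lK cU /nontrivialP K1 KU1.
have [x [Kx Ux x1]] := near1_locally_normal hG lK K1 (compact_open_near1 cU).
by apply: x1; exact: KU1.
Qed.

(** The commutator of [x] and a [y] in [L] near [1] lies in [L] because [x] normalises [L], and in
    [K] because [y] normalises [K]. *)
Lemma trivial_meet_commute K L x : locally_normal K -> locally_normal L ->
  K `&` L `<=` [set 1] -> K x -> normaliser L x -> germ_centr L x.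
Proof.
move=> lK lL KL1 Kx Lx; rewrite /germ_centr /=.
have [sK _ _] := lK; have [sL _ _] := lL.
apply: filterS (locally_normal_near1 lK) => y Ky Ly.
have /KL1 : (K `&` L) (x * y * x^-1 * y^-1).
  split.
    rewrite -!mulgA; apply: subgroupM => //; rewrite !mulgA.
    by have /normaliserP -> := Ky; exact: subgroupV.
  by apply: subgroupM => //; [have /normaliserP -> := Lx|exact: subgroupV].
move=> /= /(congr1 (fun z => z * y * x)); rewrite !gnorm.
exact.
Qed.

Lemma trivial_meet_germ_le K L : locally_normal K -> locally_normal L ->
  K `&` L `<=` [set 1] -> germ_le K (germ_centr L).
Proof.
move=> lK lL KL1; apply: filterS (locally_normal_near1 lL) => x nx Kx.
exact: (trivial_meet_commute lK).
Qed.

(* When [M] meets [A], replace [M] by [M `&` A], which is abelian; otherwise small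
   elements of [M] and [A] commute. *)
Lemma abelian_family_centr (s : seq (set G)) :
  (forall A, A \in s -> locally_normal A /\
     forall x y, A x -> A y -> x * y = y * x) ->
  exists M, [/\ locally_normal M, ~ M `<=` [set 1] &
    forall A x, A \in s -> M x -> germ_centr A x].
Proof.
elim: s => [_|A s IH sA].
  have [U cU _] := small_subgroup hG (@filterT _ (nbhs (1 : G)) _).
  exists U; split => //; first exact: compact_open_locally_normal.
  have [x Ux x1] := near1_nontrivial hG (compact_open_near1 cU).
  by move=> /(_ x Ux).
have [|M [lM M1 Ms]] := IH.
  by move=> B Bs; apply: sA; rewrite inE Bs orbT.
have [lA abA] := sA A (mem_head _ _).
have [MA1|MA1] := pselect (M `&` A `<=` [set 1]); last first.
  exists (M `&` A); split => //; first exact: locally_normalI.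
  move=> B x; rewrite inE => /orP[/eqP ->|Bs] [Mx Ax]; last exact: Ms.
  by apply: centr_germ_centr => y Ay; exact: abA.
have [U [cU _ UA]] := small_normalising lA (@filterT _ (nbhs (1 : G)) _).
exists (M `&` U); split.
- by apply: locally_normalI => //; exact: compact_open_locally_normal.
- exact: locally_normal_germI.
- move=> B x; rewrite inE => /orP[/eqP ->|Bs] [Mx Ux]; last exact: Ms.
  by apply: (trivial_meet_commute lM) => //; exact: UA.
Qed.

(** A nontrivial [A] would have finitely many conjugates whose germs are centralised by no common
    nontrivial element, whereas [abelian_family_centr] produces a nontrivial subgroup of such
    elements. *)
Lemma abelian_locally_normal_trivial A : locally_normal A ->
  (forall x y, A x -> A y -> x * y = y * x) -> A `<=` [set 1].
Proof.
move=> lA abA; apply: contrapT => A1.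
have [S [fS SA S1]] := finite_conjugates_centr hG lA (nontrivialP A1).
have [s sE] : exists s : seq (set G), S = [set` s] by exact/finite_seqP.
have [|M [lM M1 Ms]] := @abelian_family_centr s.
  move=> B Bs; have [|g ->] := SA B; first by rewrite sE.
  split; first exact: conj_set_locally_normal.
  move=> x y; rewrite conj_setE /= => Ax Ay.
  have /(congr1 (fun z => g * z * g^-1)) := abA _ _ Ax Ay.
  by rewrite !gnorm.
apply: M1 => x Mx; apply: S1 => B; rewrite sE => Bs; exact: Ms.
Qed.

(* The centraliser in [L] of an open subgroup [L `&` W] is virtually the centre
   of [L `&` W], an abelian locally normal subgroup. *)
Lemma meet_germ_centr_trivial L x : locally_normal L -> L x -> germ_centr L x ->
  x = 1.
Proof.
move=> lL Lx cx; have [sL cL _] := lL.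
have [U [cU _ UL]] := small_normalising lL (@filterT _ (nbhs (1 : G)) _).
have [W [cW WP WU UW]] := small_normal_subgroup hG cU cx.
pose Z := L `&` centr (L `&` W).
have lZ : locally_normal Z.
  apply: (locally_normal_normalised _ _ cU).
  - by apply: subgroupI => //; exact: centr_subgroup.
  - by apply: compact_closedI => //; exact: centr_closed.
  - move=> u Uu; apply: normaliserI; split; first exact: UL.
    by apply/normaliser_centr/normaliserI; split; [exact: UL|exact: UW].
apply: (germ_trivial hG lZ).
  apply: filterS (compact_open_near1 cW) => y Wy Zy.
  apply: (@abelian_locally_normal_trivial (Z `&` W)) => //.
    by apply: locally_normalI => //; exact: compact_open_locally_normal.
  by move=> a b [[_ aC] _] [[Lb _] Wb]; exact: aC.
by split => // y [Ly Wy]; exact: WP.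
Qed.

(** For [l] in [L], the commutator of [c] and [l] lies in [L], since [c] normalises [L], and in
    [germ_centr L], which [l] normalises; hence it is trivial. Commutation near [1] thus extends to
    all of [L]. *)
Lemma germ_centr_normaliser L : locally_normal L ->
  normaliser L `&` germ_centr L `<=` centr L.
Proof.
move=> lL c [nc cc] l Ll; have [sL _ _] := lL.
have sc := germ_centr_subgroup L.
suff /(congr1 (fun z => z * l * c)) : c * l * c^-1 * l^-1 = 1 by rewrite !gnorm.
apply: (meet_germ_centr_trivial lL).
  by apply: subgroupM => //; [have /normaliserP -> := nc|exact: subgroupV].
rewrite -!mulgA; apply: subgroupM => //; rewrite !mulgA.
have /normaliser_germ_centr/normaliserP -> := normaliser_sub sL Ll.
exact: subgroupV.
Qed.

(** Near [1] the right-hand side depends only on the germ of [L], which is why [perp] is well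
    defined on classes. *)
Lemma centr_germ_eq U L : locally_normal L -> U `<=` normaliser L ->
  U `&` centr L = U `&` germ_centr L.
Proof.
move=> lL UL; apply/seteqP; split=> x [Ux Cx]; split=> //.
  exact: centr_germ_centr.
by apply: germ_centr_normaliser => //; split=> //; exact: UL.
Qed.

(** [germ_centr K] may fail to be compact; the centraliser of [K] in a compact open subgroup
    normalising [K] is a locally normal subgroup with the same germ. *)
Lemma germ_centr_repr K : locally_normal K ->
  exists M, [/\ locally_normal M, germ_le M (germ_centr K) & germ_le (germ_centr K) M].
Proof.
move=> lK.
have [U [cU _ UK]] := small_normalising lK (@filterT _ (nbhs (1 : G)) _).
exists (U `&` centr K); split; first exact: locally_normal_centr.
  by apply: sub_germ_le; rewrite centr_germ_eq//; exact: subIsetr.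
rewrite centr_germ_eq//; apply: germ_leI (germ_le_refl _).
exact/near_germ_le/compact_open_near1.
Qed.

Lemma sub_germ_centr2 K : locally_normal K -> K `<=` germ_centr (germ_centr K).
Proof.
move=> lK x Kx; rewrite /germ_centr /=.
apply: filterS (locally_normal_near1 lK) => y nKy cy.
by apply/esym/(germ_centr_normaliser lK).
Qed.

Lemma germ_centr3 K : locally_normal K ->
  germ_le (germ_centr (germ_centr (germ_centr K))) (germ_centr K).
Proof.
by move=> lK; apply/sub_germ_le/germ_centrS/sub_germ_le; exact: sub_germ_centr2.
Qed.

(* The class of [K] is in LC(G). *)
Definition perp_closed K := germ_le (germ_centr (germ_centr K)) K.

(* The class of [K] is in LD(G). *)
Definition germ_factor K := forall P : set G, nbhs (1 : G) P ->
  \forall x \near (1 : G), exists k c,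
    [/\ K k, P k, germ_centr K c, P c & x = k * c].

Lemma perp_closedI K L : perp_closed K -> perp_closed L -> perp_closed (K `&` L).
Proof.
move=> cK cL; apply: germ_leI.
  apply: germ_le_trans cK; do 2! (apply/sub_germ_le/germ_centrS).
  by apply: sub_germ_le; exact: subIsetl.
apply: germ_le_trans cL; do 2! (apply/sub_germ_le/germ_centrS).
by apply: sub_germ_le; exact: subIsetr.
Qed.

Lemma perp_closed_conj g K : perp_closed K -> perp_closed (conj_set g K).
Proof.
by rewrite /perp_closed !germ_centr_conjE; exact: germ_le_conj.
Qed.

(** If [k * c] centralises the germ of [germ_centr K], so does [c]; but a locally normal subgroup
    has no nontrivial element centralising its own germ. *)
Lemma germ_factor_perp_closed K : locally_normal K -> germ_factor K -> perp_closed K.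
Proof.
move=> lK fK.
have [M [lM Mc cM]] := germ_centr_repr lK.
have cME : germ_centr M = germ_centr (germ_centr K) by exact: germ_centr_eq.
rewrite /perp_closed; have := fK _ cM.
apply: filterS => _ [k [c [Kk _ kc cMc ->]]] ccx.
suff -> : c = 1 by rewrite mulg1.
apply: (meet_germ_centr_trivial lM); first exact: cMc.
rewrite cME -[c](mulKg k); apply: subgroupM => //; first exact: germ_centr_subgroup.
by apply: subgroupV; [exact: germ_centr_subgroup|exact: sub_germ_centr2].
Qed.

Lemma germ_factor_conj g K : germ_factor K -> germ_factor (conj_set g K).
Proof.
move=> fK P P1; have := near1_conj g^-1 (fK _ (near1_conj g P1)).
apply: filterS => x [k [c [Kk Pk cc Pc]]]; rewrite invgK => xE.
exists (g * k * g^-1), (g * c * g^-1).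
rewrite germ_centr_conj; split => //; first by rewrite conj_setE /= !gnorm.
have /(congr1 (fun z => g * z * g^-1)) := xE.
by rewrite !gnorm.
Qed.

(** Split a small [x] as [a * c] along [K], then [a] as [b * d] along [L]. The factor [b] turns out
    to lie in [K], and [d * c] centralises the germ of the intersection. *)
Lemma germ_factorI K L : locally_normal K -> locally_normal L ->
  germ_factor K -> germ_factor L -> germ_factor (K `&` L).
Proof.
move=> lK lL fK fL P P1.
have cK := germ_factor_perp_closed lK fK.
have [sK _ _] := lK; have [sL _ _] := lL.
have [|U cU UP] := small_subgroup hG (P := P `&` (normaliser K `&` (normaliser L `&`
    [set x | germ_centr (germ_centr K) x -> K x]))).
  by do ! apply: filterI => //; exact: locally_normal_near1.
have U1 := compact_open_near1 cU; have [sU _ _] := cU.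
have fL1 := fL U U1.
apply: filterS (fK _ (filterI U1 fL1)) => _ [a [c [Ka [Ua faL] ca [Uc _] ->]]].
have [b [d [Lb Ub db Ud aE]]] := faL.
have [_ [nKc _]] := UP _ Uc.
have cKc : centr K c by apply: germ_centr_normaliser.
(* As [K] is [perp_closed], it is enough that [b] commutes with the elements [y] of [germ_centr K]
   near [1]; these are split along [L] as well. *)
have Kb : K b.
  have [_ [_ [_ Kb]]] := UP _ Ub; apply: Kb; rewrite /germ_centr /=.
  apply: filterS2 U1 fL1 => y Uy [e [f [Le Ue fL' Uf yE]]] cy.
  have [_ [_ [nLf _]]] := UP _ Uf; have [_ [_ [nLd _]]] := UP _ Ud.
  have [_ [nKy _]] := UP _ Uy.
  have Ly := germ_centr_normaliser lL (conj nLf fL').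
  have Ld := germ_centr_normaliser lL (conj nLd db).
  have yK : centr K y by apply: germ_centr_normaliser.
  have ay := yK a Ka.
  have bf : b * f = f * b by rewrite Ly.
  have de : d * e = e * d by rewrite Ld.
  have bd : b * d = d * b by rewrite Ld.
  (* [a = b d] and [y = e f] commute, hence so do [b] and [e], since [L] meets
     its centraliser trivially *)
  have be : b * e = e * b.
    have h1 : b * e * (d * f) = e * b * (f * d).
      have : e * f * (b * d) = b * d * (e * f) by rewrite -aE -yE.
      move=> h; rewrite -!mulgA [e * (d * f)]mulgA -de -!mulgA (mulgA b).
      rewrite -h -!mulgA; congr (e * _); rewrite !mulgA; congr (_ * _).
      by rewrite bf.
    have : (e * b)^-1 * (b * e) = (f * d) * (d * f)^-1.
      apply: (mulIg (d * f)); rewrite -[in LHS]mulgA h1 [in LHS]mulgA mulVg mul1g.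
      by rewrite mulgVK.
    set z := _ * _; move=> zE.
    have Lz : L z.
      by apply: subgroupM => //; [apply: subgroupV => //|]; exact: subgroupM.
    have cz : germ_centr L z.
      have sc := germ_centr_subgroup L.
      by rewrite zE; apply: subgroupM => //; [|apply: subgroupV => //]; exact: subgroupM.
    have := meet_germ_centr_trivial lL Lz cz; rewrite /z => /(congr1 (fun t => e * b * t)).
    by rewrite mulVKg mulg1.
  by rewrite yE mulgA be -mulgA bf mulgA.
exists b, (d * c); split => //.
- by have [] := UP _ Ub.
- apply: subgroupM; first exact: germ_centr_subgroup.
    by apply: germ_centrS db; apply: sub_germ_le; exact: subIsetr.
  by apply: germ_centrS ca; apply: sub_germ_le; exact: subIsetl.
- by have [] : P (d * c) /\ True by split => //; apply: (UP _ (subgroupM sU Ud Uc)).1.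
- by rewrite aE mulgA.
Qed.

(** An atom among the classes whose representatives satisfy [Q], where [Q] is [perp_closed] for
    LC(G), [germ_factor] for LD(G) and always true for LN(G). *)
Definition germ_atom (Q : set G -> Prop) K :=
  [/\ locally_normal K, Q K, ~ K `<=` [set 1] &
    forall M, locally_normal M -> Q M -> ~ M `<=` [set 1] -> germ_le M K ->
      germ_le K M].

Lemma conj_set_trivial g K : conj_set g K `<=` [set 1] <-> K `<=` [set 1].
Proof.
split=> K1 x Kx.
  have := K1 (g * x * g^-1); rewrite conj_setE /= !gnorm => /(_ Kx).
  by move=> /(congr1 (fun z => g^-1 * z * g)); rewrite !gnorm.
move: Kx; rewrite conj_setE => /K1 /= /(congr1 (fun z => g * z * g^-1)).
by rewrite !gnorm.
Qed.

Lemma germ_atom_conj (Q : set G -> Prop) g K : (forall h L, Q L -> Q (conj_set h L)) ->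
  germ_atom Q K -> germ_atom Q (conj_set g K).
Proof.
move=> Qc [lK QK K1 Kmin]; split.
- exact: conj_set_locally_normal.
- exact: Qc.
- by move=> /conj_set_trivial.
- move=> M lM QM M1 /(germ_le_conj g^-1); rewrite conj_setM mulVg conj_set1g.
  move=> /Kmin h; rewrite -[M](conj_set1g) -(mulgV g) -conj_setM.
  apply: germ_le_conj; apply: h; [exact: conj_set_locally_normal|exact: Qc|].
  by move=> /conj_set_trivial.
Qed.

(* Two distinct conjugates of an atom meet trivially, so a conjugate different
   from all members of the finite family of [finite_conjugates_centr] would
   centralise it; hence the atom has a finite orbit and [G] fixes it. *)
Lemma germ_atom_full (Q : set G -> Prop) K :
  (forall g L, Q L -> Q (conj_set g L)) ->
  (forall L M, locally_normal L -> locally_normal M -> Q L -> Q M -> Q (L `&` M)) ->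
  (forall L, locally_normal L -> Q L -> perp_closed L) ->
  germ_atom Q K -> \forall x \near (1 : G), K x.
Proof.
move=> Qc QI Qcl aK; have [lK QK K1 _] := aK.
have [S [fS SK S1]] := finite_conjugates_centr hG lK (nontrivialP K1).
have orbit g : exists A, [/\ S A, germ_le (conj_set g K) A & germ_le A (conj_set g K)].
  apply: contrapT => nS.
  have [lK' QK' K'1 K'min] := germ_atom_conj g Qc aK.
  have h A : S A -> germ_le (conj_set g K) (germ_centr A).
    move=> SA; have [h AE] := SK A SA.
    have [lA QA A1 Amin] := germ_atom_conj h Qc aK; rewrite -AE in lA QA A1 Amin.
    apply: trivial_meet_germ_le => //; apply: contrapT => KA1; apply: nS.
    have lKA := locally_normalI lK' lA; have QKA := QI _ _ lK' lA QK' QA.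
    have KAl := sub_germ_le (@subIsetl _ (conj_set g K) A).
    have KAr := sub_germ_le (@subIsetr _ (conj_set g K) A).
    exists A; split => //.
      by apply: germ_le_trans KAr; exact: K'min.
    by apply: germ_le_trans KAl; exact: Amin.
  have : \forall x \near (1 : G), forall A, S A -> conj_set g K x -> germ_centr A x.
    by apply: near_finite => // A /h.
  move=> /(near1_locally_normal hG lK' (nontrivialP K'1))[x [Kx cx]]; apply.
  by apply: S1 => A SA; exact: cx.
(* The kernel of the action of [G] on the germs of the conjugates of [K]. It is open, since by
   [orbit] it contains every element normalising all members of the finite [S]. *)
pose N := [set x | forall g, germ_le (conj_set (x * g) K) (conj_set g K) /\
                             germ_le (conj_set g K) (conj_set (x * g) K)].
have sN : subgroup N.
  apply/subgroupP; split=> [g|x y Nx Ny g].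
    by rewrite mul1g; split; exact: germ_le_refl.
  rewrite -mulgA; have [xy yx] := Nx (y^-1 * g); have := Ny (y^-1 * g).
  rewrite mulVKg => -[Ny1 Ny2].
  by split; [exact: germ_le_trans xy Ny2|exact: germ_le_trans Ny1 yx].
have N1 : \forall x \near (1 : G), N x.
  have : \forall x \near (1 : G), forall A, S A -> normaliser A x.
    apply: near_finite => // A /SK[g ->].
    exact/locally_normal_near1/conj_set_locally_normal.
  apply: filterS => x nx g; have [A [SA gA Ag]] := orbit g.
  have /= xA := nx A SA; rewrite -conj_setM; split.
    by apply: germ_le_trans Ag; rewrite -xA; exact: germ_le_conj.
  by apply: (germ_le_trans gA); rewrite -{1}xA; exact: germ_le_conj.
have NT : N = setT.
  apply: closed_normal_full => //.
  - by apply: open_subgroup_closed => //; exact: subgroup_open.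
  - have Nconj g x : N x -> N (g * x * g^-1).
      move=> Nx h; have := Nx (g^-1 * h) => -[].
      move=> /(germ_le_conj g) h1 /(germ_le_conj g) h2; move: h1 h2.
      by rewrite !conj_setM !gnorm.
    apply/seteqP; split=> // g _; apply/normaliserP => x; apply/propext; split.
      by move=> /(Nconj g^-1); rewrite !gnorm.
    exact: Nconj.
  - exact: near1_nontrivial.
have fixK x : germ_le (conj_set x K) K /\ germ_le K (conj_set x K).
  have : N x by rewrite NT.
  by move=> /(_ 1); rewrite mulg1 conj_set1g.
(* All members of [S] now have the germ of [K], so an element centralising that germ centralises all
   of theirs. The double centraliser is then [G], and [perp_closed] makes [K] a neighbourhood of
   [1]. *)
have cK1 : germ_centr K `<=` [set 1].
  move=> x cx; apply: S1 => A /SK[g ->]; have [gK Kg] := fixK g.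
  by apply: (germ_centrS gK).
have := Qcl K lK QK; rewrite /perp_closed /germ_le => ccK.
apply: filterS ccK => x; apply; rewrite /germ_centr /=.
by near=> y => /cK1 ->; rewrite !gnorm.
Unshelve. all: by end_near. Qed.

(* A conjugate [A] of [K] satisfies [[A, B] <= A] locally, and [A] lies below [B];
   so [A] fixes the germ of [B], as does the open subgroup [normaliser B]. *)
Lemma least_germ_fixed K B : locally_normal K -> locally_normal B ->
  ~ K `<=` [set 1] ->
  (forall L, locally_normal L -> ~ L `<=` [set 1] -> germ_le K L) ->
  ~ B `<=` [set 1] ->
  forall g, germ_le (conj_set g B) B /\ germ_le B (conj_set g B).
Proof.
move=> lK lB K1 Kmin B1.
pose St := [set g | germ_le (conj_set g B) B /\ germ_le B (conj_set g B)].
suff StT : St = setT by move=> g; have : St g by rewrite StT.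
have sSt : subgroup St.
  apply/subgroupP; split=> [|x y [x1 x2] [y1 y2]].
    by rewrite /St /= conj_set1g; split; exact: germ_le_refl.
  have := germ_le_conj (x * y^-1) y1; have := germ_le_conj (x * y^-1) y2.
  rewrite conj_setM mulgVK => h1 h2.
  by split; [exact: germ_le_trans h1 x1|exact: germ_le_trans x2 h2].
pose P := [set x | exists g, conj_set g K x].
have [k Kk k1] := nontrivialP K1.
apply: (normal_closure_dense hG (P := P) (U := normaliser B)) => //.
- move=> g x [h hx]; exists (g * h); rewrite -conj_setM.
  by rewrite conj_setE /= !gnorm.
- by exists k => //; exists 1; rewrite conj_set1g.
- exact: locally_normal_near1.
- by move=> g /= nB; rewrite /St /= nB; split; exact: germ_le_refl.
- have PB x : P x -> germ_le (conj_set x B) B.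
    move=> [g Ax]; set A := conj_set g K in Ax.
    have lA : locally_normal A by exact: conj_set_locally_normal.
    have [sA _ _] := lA; have [sB _ _] := lB.
    have AB : germ_le A B.
      have := Kmin _ (conj_set_locally_normal g^-1 lB).
      move=> /(_ _)/(germ_le_conj g); rewrite conj_setM mulgV conj_set1g; apply.
      by move=> /conj_set_trivial.
    rewrite /germ_le conj_setE /=.
    have := near1_conj x^-1 (near1_commg x AB).
    have := near1_conj x^-1 (locally_normal_near1 lA).
    apply: filterS2 => y; rewrite !invgK => nA + By.
    (* [y] lies in the conjugate of [B] by [x] iff [t] lies in [B]; the quotient [t^-1 * y] is a
       commutator of [t] and [x] lying in [A], hence in [B] near [1]. *)
    set t := x^-1 * y * x in nA By *.
    have -> : x * t * x^-1 = y by rewrite /t !gnorm.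
    have At : A (t^-1 * y).
      have -> : t^-1 * y = t^-1 * x * t * x^-1 by rewrite /t !gnorm.
      apply: subgroupM => //; last exact: subgroupV.
      by have /normaliserV/normaliserP := nA; rewrite invgK => ->.
    move=> /(_ At) Bt.
    by rewrite -[y](mulVKg t); exact: subgroupM.
  move=> x Px; split; first exact: PB.
  have Px' : P x^-1.
    case: Px => g Ax; exists g; apply: subgroupV => //.
    by apply: conj_set_subgroup; case: lK.
  have := germ_le_conj x (PB _ Px').
  by rewrite conj_setM mulgV conj_set1g.
Qed.

End Germs.

Lemma exists_minimal (T : eqType) (R : T -> T -> Prop) (s : seq T) :
  (forall x y z, x \in s -> y \in s -> z \in s -> R x y -> R y z -> R x z) ->
  (forall x y, x \in s -> y \in s -> R x y -> R y x -> x = y) ->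
  s != [::] -> exists2 m, m \in s & forall b, b \in s -> R b m -> b = m.
Proof.
elim: s => // x [_ _ _ _|y s IH Rt Ra _].
  by exists x; [exact: mem_head|move=> b; rewrite inE => /eqP].
have [||//|m ms mmin] := IH.
- by move=> a b c ? ? ?; apply: Rt; rewrite inE; apply/orP; right.
- by move=> a b ? ?; apply: Ra; rewrite inE; apply/orP; right.
have ms' : m \in x :: y :: s by rewrite inE ms orbT.
have xs : x \in x :: y :: s := mem_head _ _.
have [Rxm|nRxm] := pselect (R x m).
  exists x => // b; rewrite inE => /orP[/eqP //|bs] Rbx.
  have bs' : b \in x :: y :: s by rewrite inE bs orbT.
  have bm : b = m by apply: mmin => //; exact: (Rt b x m).
  by apply: Ra => //; rewrite bm.
exists m => // b; rewrite inE => /orP[/eqP -> /nRxm//|bs]; exact: mmin.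
Qed.

(** * The structure lattice *)

Section StructureLattice.
Variable G : topologicalGroupType.
Hypothesis hG : class_S G.
Implicit Types (g h x y : G) (A B C H K L M N U V W X : set G).
Implicit Types (Lat : set (set (set G))).

Let hausG : hausdorff_space G. Proof. by case: hG => -[]. Qed.

Lemma finite_index_germP K L : locally_normal K -> locally_normal L ->
  finite_index K (K `&` L) <-> germ_le K L.
Proof.
move=> [sK cK _] [sL cL _].
by split; [exact: finite_index_near1|exact: near1_finite_index].
Qed.

Lemma comm_classP K L : locally_normal K ->
  comm_class K L <-> [/\ locally_normal L, germ_le K L & germ_le L K].
Proof.
move=> lK; split=> [[lL [KL LK]]|[lL KL LK]].
  split => //; first exact/finite_index_germP.
  by apply/finite_index_germP => //; rewrite setIC.
split => //; split; first exact/finite_index_germP.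
by rewrite setIC; exact/finite_index_germP.
Qed.

Lemma comm_class_refl K : locally_normal K -> comm_class K K.
Proof. by move=> lK; apply/comm_classP => //; split => //; exact: germ_le_refl. Qed.

Lemma comm_class_eqP K L : locally_normal K -> locally_normal L ->
  comm_class K = comm_class L <-> germ_le K L /\ germ_le L K.
Proof.
move=> lK lL; split=> [E|[KL LK]].
  by have := comm_class_refl lL; rewrite -E => /(comm_classP _ lK)[].
apply/seteqP; split=> M /comm_classP[]// lM h1 h2; apply/comm_classP => //.
  by split => //; [exact: germ_le_trans LK h1|exact: germ_le_trans h2 KL].
by split => //; [exact: germ_le_trans KL h1|exact: germ_le_trans h2 LK].
Qed.

Lemma LN_leP K L : locally_normal K -> locally_normal L ->
  LN_le (comm_class K) (comm_class L) <-> germ_le K L.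
Proof.
move=> lK lL; split.
  move=> [K' [L' [/comm_classP[]// lK' KK' K'K /comm_classP[]// lL' LL' L'L]]].
  move=> /finite_index_germP -/(_ lK' lL') K'L'.
  exact: germ_le_trans KK' (germ_le_trans K'L' L'L).
move=> KL; exists K, L; split; try exact: comm_class_refl.
exact/finite_index_germP.
Qed.

Lemma LN_comm_class K : locally_normal K -> LN G (comm_class K).
Proof. by move=> lK; exists K. Qed.

Lemma LN_conj_comm_class g K : locally_normal K ->
  LN_conj g (comm_class K) = comm_class (conj_set g K).
Proof.
move=> lK; have lgK := conj_set_locally_normal g lK.
apply/seteqP; split=> [_ [M /comm_classP[]// lM KM MK <-]|M /comm_classP[]// lM KM MK].
  apply/comm_classP => //; split; first exact: conj_set_locally_normal.
    exact: germ_le_conj.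
  exact: germ_le_conj.
exists (conj_set g^-1 M); last by rewrite conj_setM mulgV conj_set1g.
apply/comm_classP => //; split; first exact: conj_set_locally_normal.
  by have := germ_le_conj g^-1 KM; rewrite conj_setM mulVg conj_set1g.
by have := germ_le_conj g^-1 MK; rewrite conj_setM mulVg conj_set1g.
Qed.

Lemma LN0_eqP K : locally_normal K -> comm_class K = LN0 G <-> K `<=` [set 1].
Proof.
move=> lK; have l1 := locally_normal1 G; split.
  move=> /(comm_class_eqP lK l1)[K1 _]; exact: germ_trivial.
move=> K1; apply/comm_class_eqP => //; split; first exact: sub_germ_le.
by apply: sub_germ_le => _ ->; case: lK => /subgroup1.
Qed.

Lemma LNooE U : compact_open_subgroup U -> LNoo G = comm_class U.
Proof.
move=> cU; apply/seteqP; split=> [M [V cV VM]|M UM]; last by exists U.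
have lU := compact_open_locally_normal cU; have lV := compact_open_locally_normal cV.
suff <- : comm_class V = comm_class U by [].
by apply/comm_class_eqP => //; split; exact/near_germ_le/compact_open_near1.
Qed.

Lemma compact_open_exists : exists U, @compact_open_subgroup G U.
Proof. by have [U cU _] := small_subgroup hG (@filterT _ (nbhs (1 : G)) _); exists U. Qed.

Lemma LNoo_eqP K : locally_normal K ->
  comm_class K = LNoo G <-> \forall x \near (1 : G), K x.
Proof.
move=> lK; have [U cU] := compact_open_exists; rewrite (LNooE cU).
have lU := compact_open_locally_normal cU; have U1 := compact_open_near1 cU.
split=> [/(comm_class_eqP lK lU)[_ UK]|K1].
  by apply: filterS2 U1 UK => x Ux; apply.
by apply/comm_class_eqP => //; split; exact: near_germ_le.
Qed.

Lemma LN0_LNoo : LN0 G <> LNoo G.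
Proof.
move=> /(LNoo_eqP (locally_normal1 G)) /(near1_nontrivial hG)[x].
by [].
Qed.

(** For every admissible pair the centraliser has the germ of [germ_centr K], so the union defining
    [perp] is a single class. *)
Lemma perp_comm_class K M : locally_normal K -> locally_normal M ->
  germ_le M (germ_centr K) -> germ_le (germ_centr K) M ->
  perp (comm_class K) = comm_class M.
Proof.
move=> lK lM McK cKM.
have perpE L U : comm_class K L -> compact_open_subgroup U ->
    normal_subgroup U L -> comm_class (centraliser U L) = comm_class M.
  move=> /comm_classP[]// lL KL LK cU [_ _ UL].
  have lC : locally_normal (centraliser U L) by exact: locally_normal_centr.
  apply/comm_class_eqP => //; rewrite centraliserE centr_germ_eq//.
  rewrite -(germ_centr_eq KL LK); split.
    by apply: germ_le_trans cKM; apply: sub_germ_le; exact: subIsetr.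
  by apply: germ_leI => //; exact/near_germ_le/compact_open_near1.
apply/seteqP; split=> [N [[L U] /= [KL cU _ nL]]|N MN].
  by rewrite (perpE L U).
(* An admissible pair exists, so the union is not empty: [K] is cut down by a [U] normalising it. *)
have [U [cU _ UK]] := small_normalising hG lK (@filterT _ (nbhs (1 : G)) _).
have lU := compact_open_locally_normal cU; have lKU := locally_normalI hG lK lU.
have [sKU cKU _] := lKU; have [sU _ _] := cU.
have KKU : comm_class K (K `&` U).
  apply/comm_classP => //; split => //; last by apply: sub_germ_le; exact: subIsetl.
  by apply: germ_leI (germ_le_refl _) _; exact/near_germ_le/compact_open_near1.
have nKU : normal_subgroup U (K `&` U).
  split; [by []|exact: subIsetr|move=> u Uu; apply: normaliserI].
  by split; [exact: UK|exact: normaliser_sub].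
exists (K `&` U, U); first by split => //=; exact: compact_closed.
by rewrite /= (perpE (K `&` U)).
Qed.

(** Triple centralisers reduce to simple ones, so complements are closed; conversely, a closed class
    is the complement of its own complement. *)
Lemma LC_comm_class K : locally_normal K ->
  LC G (comm_class K) <-> perp_closed K.
Proof.
move=> lK; split=> [[_ [L lL <-]]|cK].
  have [M [lM Mc cM]] := germ_centr_repr hG lL.
  rewrite (perp_comm_class lL lM Mc cM) => /(comm_class_eqP lM lK)[MK KM].
  have -> : perp_closed K = perp_closed M.
    rewrite /perp_closed (germ_centr_eq MK KM); apply/propext; split=> h.
      exact: germ_le_trans h KM.
    exact: germ_le_trans h MK.
  have := germ_centr3 hG lL; rewrite /perp_closed.
  rewrite -(germ_centr_eq Mc cM) => h; exact: germ_le_trans h cM.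
have [M [lM Mc cM]] := germ_centr_repr hG lK.
exists (comm_class M); first exact: LN_comm_class.
apply: perp_comm_class => //; rewrite (germ_centr_eq Mc cM)//.
by apply: sub_germ_le; exact: sub_germ_centr2.
Qed.

Lemma product_subgroup K C : subgroup K -> subgroup C -> C `<=` centr K ->
  subgroup [set k * c | k in K & c in C].
Proof.
move=> sK sC CK; apply/subgroupP; split.
  exists 1; first exact: subgroup1.
  by exists 1; [exact: subgroup1|rewrite mulg1].
move=> _ _ [k Kk [c Cc <-]] [k' Kk' [c' Cc' <-]].
exists (k * k'^-1); first by apply: subgroupM => //; exact: subgroupV.
exists (c * c'^-1); first by apply: subgroupM => //; exact: subgroupV.
have Kk'V := subgroupV sK Kk'.
have Ccc : C (c * c'^-1) by apply: subgroupM => //; exact: subgroupV.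
by rewrite invgM -!mulgA; congr (k * _); rewrite -(CK _ Ccc _ Kk'V) !mulgA.
Qed.

Lemma image2_compact (A B : set G) : compact A -> compact B ->
  compact [set a * b | a in A & b in B].
Proof.
move=> cA cB.
have -> : [set a * b | a in A & b in B] = (fun p : G * G => p.1 * p.2) @` (A `*` B).
  apply/seteqP; split=> [_ [a Aa [b Bb <-]]|_ [[a b] [/= Aa Bb] <-]].
    by exists (a, b).
  by exists a => //; exists b.
apply: (@continuous_compact _ _ (fun p : G * G => p.1 * p.2)); last exact: compact_setX.
by apply: continuous_subspaceT; exact: mulg_continuous.
Qed.

(** The products with a factor outside the interior of [P] form a compact set; it misses [1] because
    [K] and [C] meet trivially. *)
Lemma near1_factors K C (P : set G) : subgroup K -> compact K -> compact C ->
  subgroup C -> K `&` C `<=` [set 1] -> nbhs (1 : G) P ->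
  \forall x \near (1 : G), forall k c, K k -> C c -> x = k * c -> P k /\ P c.
Proof.
move=> sK cK cC sC KC1 P1.
have P1' : P° 1 by apply: nbhs_singleton; exact: nbhs_interior.
have clP : closed (~` P°) by apply: open_closedC; exact: open_interior.
have KC k c : K k -> C c -> k * c = 1 -> k = 1 /\ c = 1.
  move=> Kk Cc /mulg1_eq E; have k1 : k^-1 = 1.
    by apply: KC1; split; [exact: subgroupV|rewrite E].
  by rewrite -E k1 -[k]invgK k1 invg1.
have near_not A B : compact A -> compact B -> ~ [set a * b | a in A & b in B] 1 ->
    \forall x \near (1 : G), ~ [set a * b | a in A & b in B] x.
  move=> cA cB nAB; have cl := compact_closed hausG (image2_compact cA cB).
  exact: (open_nbhs_nbhs (conj (closed_openC cl) nAB)).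
have n1 : ~ [set a * b | a in K & b in C `&` ~` P°] 1.
  by move=> [k Kk [c [Cc nPc] /(KC _ _ Kk Cc)[_ c1]]]; apply: nPc; rewrite c1.
have n2 : ~ [set a * b | a in K `&` ~` P° & b in C] 1.
  by move=> [k [Kk nPk] [c Cc /(KC _ _ Kk Cc)[k1 _]]]; apply: nPk; rewrite k1.
have N1 := near_not _ _ cK (compact_closedI cC clP) n1.
have N2 := near_not _ _ (compact_closedI cK clP) cC n2.
apply: filterS2 N1 N2 => x nx1 nx2 k c Kk Cc xE; split; apply: contrapT => nP.
  apply: nx2; exists k; first by split=> // /interior_subset.
  by exists c.
by apply: nx1; exists k => //; exists c => //; split=> // /interior_subset.
Qed.

(** If the join is the maximum, the product [J] of an open subgroup of [K] with its centraliser part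
    [C], being an upper bound of both classes, is a neighbourhood of [1]; [near1_factors] makes the
    factors small. Conversely, an upper bound contains the small factors, hence their products. *)
Lemma LD_comm_class K : locally_normal K ->
  LD G (comm_class K) <-> germ_factor K.
Proof.
move=> lK; have [M [lM Mc cM]] := germ_centr_repr hG lK.
have perpE := perp_comm_class lK lM Mc cM.
have [U0 cU0] := compact_open_exists; have lU0 := compact_open_locally_normal cU0.
have LNooE0 := LNooE cU0.
split=> [[_ [_ _ _ ooleast]] P P1|fK].
  have [U [cU _ UK]] := small_normalising hG lK (@filterT _ (nbhs (1 : G)) _).
  have lU := compact_open_locally_normal cU.
  have [sU cpU _] := cU; have U1 := compact_open_near1 cU.
  have lKU := locally_normalI hG lK lU.
  pose C := U `&` centr K.
  have lC : locally_normal C by exact: locally_normal_centr.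
  have [sKU cKU _] := lKU; have [sC cC _] := lC.
  pose J := [set k * c | k in K `&` U & c in C].
  have UJ : U `<=` normaliser J.
    have Jconj u x : U u -> J x -> J (u * x * u^-1).
      move=> Uu [k [Kk Uk] [c Cc <-]]; exists (u * k * u^-1).
        split; first by have /normaliserP -> := UK u Uu.
        by have /normaliserP -> := normaliser_sub sU Uu.
      exists (u * c * u^-1); last by rewrite !gnorm.
      have : normaliser C u.
        apply: normaliserI; split; first exact: normaliser_sub.
        by apply: normaliser_centr; exact: UK.
      by move=> /normaliserP ->.
    move=> u Uu; apply/normaliserP => x; apply/propext; split; last exact: Jconj.
    by move=> /(Jconj u^-1 _ (subgroupV sU Uu)); rewrite !gnorm.
  have lJ : locally_normal J.
    apply: (locally_normal_normalised _ _ cU UJ).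
      by apply: product_subgroup => // c [_ cc] k [Kk _]; exact: cc.
    exact: image2_compact.
  have J1 : \forall x \near (1 : G), J x.
    have KJ : germ_le K J.
      apply: filterS U1 => x Ux Kx; exists x => //.
      by exists 1; [exact: subgroup1|rewrite mulg1].
    have MJ : germ_le M J.
      apply: (germ_le_trans Mc); apply: filterS U1 => x Ux cx.
      exists 1; first exact: subgroup1.
      by exists x; [rewrite /C centr_germ_eq|rewrite mul1g].
    have := ooleast _ (LN_comm_class lJ); rewrite LNooE0 perpE.
    move=> /(_ (iffRL (LN_leP lK lJ) KJ) (iffRL (LN_leP lM lJ) MJ)).
    move=> /(LN_leP lU0 lJ) UJ'.
    by apply: filterS2 (compact_open_near1 cU0) UJ' => x Ux; exact.
  have KC1 : (K `&` U) `&` C `<=` [set 1].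
    move=> x [[Kx _] [_ cx]]; apply: (meet_germ_centr_trivial hG lK Kx).
    exact: centr_germ_centr.
  apply: filterS2 J1 (near1_factors sKU cKU cC sC KC1 P1) => x [k KUk [c Cc xE]] h.
  have [Pk Pc] := h k c KUk Cc (esym xE).
  exists k, c; split => //; first by case: KUk.
  by apply: centr_germ_centr; case: Cc.
split; first exact: LN_comm_class.
rewrite perpE LNooE0; split; first exact: LN_comm_class.
- by apply/LN_leP => //; exact/near_germ_le/compact_open_near1.
- by apply/LN_leP => //; exact/near_germ_le/compact_open_near1.
- move=> _ [N lN <-] /LN_leP -/(_ lK lN) KN /LN_leP -/(_ lM lN) MN.
  apply/LN_leP => //.
  have cN := germ_le_trans cM MN; have [sN _ _] := lN.
  have KN' : nbhs (1 : G) [set x | K x -> N x] by exact: KN.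
  have cN' : nbhs (1 : G) [set x | germ_centr K x -> N x] by exact: cN.
  apply: filterS (fK _ (filterI KN' cN')) => _ [k [c [Kk [Nk _] cc [_ Nc] ->]]] _.
  by apply: subgroupM => //; [exact: Nk|exact: Nc].
Qed.

Lemma LC_sub_LN : LC G `<=` LN G.
Proof.
move=> _ [_ [L lL <-] <-]; have [M [lM Mc cM]] := germ_centr_repr hG lL.
by rewrite (perp_comm_class lL lM Mc cM); exact: LN_comm_class.
Qed.

Lemma LD_sub_LN : LD G `<=` LN G.
Proof. by move=> a []. Qed.

Lemma LD_sub_LC : LD G `<=` LC G.
Proof.
move=> a /[dup] /LD_sub_LN[K lK <-] /(LD_comm_class lK) fK.
by apply/LC_comm_class => //; exact: germ_factor_perp_closed.
Qed.

Lemma germ_factor_full K : (\forall x \near (1 : G), K x) -> germ_factor K.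
Proof.
move=> K1 P P1; have P0 := nbhs_singleton P1; apply: filterS2 K1 P1 => x Kx Px; exists x, 1.
rewrite mulg1; split => //; first by apply: subgroup1; exact: germ_centr_subgroup.
Qed.

Lemma germ_factor1 : germ_factor [set (1 : G)].
Proof.
move=> P P1; have P0 := nbhs_singleton P1.
apply: filterS P1 => x Px; exists 1, x; rewrite mul1g; split => //.
rewrite /germ_centr /=.
by near=> y => ->; rewrite !gnorm.
Unshelve. all: by end_near. Qed.

Lemma LD0 : LD G (LN0 G).
Proof.
by apply/LD_comm_class; [exact: locally_normal1|exact: germ_factor1].
Qed.

Lemma LDoo : LD G (LNoo G).
Proof.
have [U cU] := compact_open_exists; rewrite (LNooE cU).
apply/LD_comm_class; first exact: compact_open_locally_normal.
by apply: germ_factor_full; exact: compact_open_near1.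
Qed.

(** A finite [Lat] without its minimum would be nonempty, as it contains the maximum, and its
    minimal elements would be atoms. *)
Lemma non_atomic_infinite Lat : Lat `<=` LN G -> Lat (LNoo G) -> non_atomic Lat ->
  infinite_set Lat.
Proof.
move=> LatLN Latoo naL fL.
have fD : finite_set (Lat `&` [set a | a <> LN0 G]) by exact: finite_setIl.
have [s sE] : exists s : seq (set (set G)), Lat `&` [set a | a <> LN0 G] = [set` s].
  exact/finite_seqP.
have sP a : a \in s -> Lat a /\ a <> LN0 G.
  by move=> sa; have : (Lat `&` [set a | a <> LN0 G]) a by rewrite sE.
have Ps a : Lat a -> a <> LN0 G -> a \in s.
  move=> La a0; have : (Lat `&` [set a | a <> LN0 G]) a by [].
  by rewrite sE.
have [|||m ms mmin] := @exists_minimal _ (@LN_le G) s.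
- move=> a b c /sP[/LatLN[K lK <-] _] /sP[/LatLN[L lL <-] _] /sP[/LatLN[M lM <-] _].
  move=> /(LN_leP lK lL) h1 /(LN_leP lL lM) h2.
  by apply/LN_leP => //; exact: germ_le_trans h1 h2.
- move=> a b /sP[/LatLN[K lK <-] _] /sP[/LatLN[L lL <-] _].
  move=> /(LN_leP lK lL) h1 /(LN_leP lL lK) h2.
  exact/comm_class_eqP.
- have := Ps _ Latoo (nesym LN0_LNoo).
  by case: (s).
apply: naL; exists m; have [Lm m0] := sP m ms; split => // b Lb b0 bm.
by apply: mmin => //; exact: Ps.
Qed.

Lemma atom_germ_atom Lat (Q : set G -> Prop) a : Lat `<=` LN G ->
  (forall K, locally_normal K -> Lat (comm_class K) <-> Q K) ->
  atom Lat a -> exists2 K, germ_atom Q K & a = comm_class K.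
Proof.
move=> LatLN LatQ [La a0 amin]; have [K lK KE] := LatLN a La.
rewrite -KE in La a0 amin; exists K => //; split => //.
- exact/LatQ.
- by move=> /(LN0_eqP lK).
- move=> M lM QM M1 MK.
  have : comm_class M = comm_class K.
    by apply: amin; [exact/LatQ|move=> /(LN0_eqP lM)|exact/LN_leP].
  by move=> /(comm_class_eqP lM lK)[].
Qed.

(** By [germ_atom_full] an atom equals the maximum, so every nonzero element, lying below it, equals
    it too. This serves LC(G) and LD(G) alike. *)
Lemma non_atomic_dichotomy Lat (Q : set G -> Prop) : Lat `<=` LN G ->
  Lat (LN0 G) -> Lat (LNoo G) ->
  (forall K, locally_normal K -> Lat (comm_class K) <-> Q K) ->
  (forall g K, Q K -> Q (conj_set g K)) ->
  (forall K L, locally_normal K -> locally_normal L -> Q K -> Q L -> Q (K `&` L)) ->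
  (forall K, locally_normal K -> Q K -> perp_closed K) ->
  Lat <> [set LN0 G; LNoo G] -> non_atomic Lat.
Proof.
move=> LatLN Lat0 Latoo LatQ Qc QI Qcl Lat01 [a aa]; apply: Lat01.
have [K aK aE] := atom_germ_atom LatLN LatQ aa; have [lK _ _ _] := aK.
have aoo : a = LNoo G by rewrite aE; apply/LNoo_eqP => //; exact: germ_atom_full aK.
have [_ _ amin] := aa.
apply/seteqP; split=> [b Lb|b [->|->]//].
have [->|b0] := pselect (b = LN0 G); [by left|right].
rewrite /= -aoo; apply: amin => //; rewrite aoo.
have [U cU] := compact_open_exists; rewrite (LNooE cU).
have [L lL <-] := LatLN b Lb; apply/LN_leP => //; first exact: compact_open_locally_normal.
exact/near_germ_le/compact_open_near1.
Qed.

Lemma LC_non_atomic : LC G <> [set LN0 G; LNoo G] -> non_atomic (LC G).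
Proof.
apply: (@non_atomic_dichotomy _ (@perp_closed G)).
- exact: LC_sub_LN.
- exact/LD_sub_LC/LD0.
- exact/LD_sub_LC/LDoo.
- exact: LC_comm_class.
- by move=> g K; exact: perp_closed_conj.
- by move=> K L _ _; exact: perp_closedI.
- by [].
Qed.

Lemma LD_non_atomic : LD G <> [set LN0 G; LNoo G] -> non_atomic (LD G).
Proof.
apply: (@non_atomic_dichotomy _ (@germ_factor G)).
- exact: LD_sub_LN.
- exact: LD0.
- exact: LDoo.
- exact: LD_comm_class.
- by move=> g K; exact: germ_factor_conj.
- by move=> K L; exact: germ_factorI.
- by move=> K; exact: germ_factor_perp_closed.
Qed.

(** If the meet is trivial, [K] lies below the complement of [L], which is zero or the maximum. Zero
    makes [K] trivial; the maximum makes [L] centralise its own germ near [1], hence trivial. *)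
Lemma trivial_LC_meet K L : LC G = [set LN0 G; LNoo G] ->
  locally_normal K -> locally_normal L -> ~ K `<=` [set 1] -> ~ L `<=` [set 1] ->
  ~ K `&` L `<=` [set 1].
Proof.
move=> LC01 lK lL K1 L1 KL1.
have [M [lM Mc cM]] := germ_centr_repr hG lL.
have KM : germ_le K M by apply: germ_le_trans cM; exact: trivial_meet_germ_le.
have : LC G (comm_class M).
  by exists (comm_class L); [exact: LN_comm_class|exact: perp_comm_class].
rewrite LC01 => -[/(LN0_eqP lM) M1|/(LNoo_eqP lM) M1].
  apply: K1; apply: (germ_trivial hG lK).
  by move: KM; rewrite /germ_le; apply: filterS => x KM /KM/M1.
apply: L1; apply: (germ_trivial hG lL).
apply: filterS2 M1 Mc => x Mx /(_ Mx) cx Lx.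
exact: (meet_germ_centr_trivial hG lL).
Qed.

Lemma LN_non_atomic : LC G = [set LN0 G; LNoo G] -> ~ trivial_action (LN G) ->
  non_atomic (LN G).
Proof.
move=> LC01 ntriv [a aa]; apply: ntriv.
have LNQ K : locally_normal K -> LN G (comm_class K) <-> True.
  by move=> lK; split => // _; exact: LN_comm_class.
have [K aK aE] := atom_germ_atom (@subset_refl _ _) LNQ aa.
have [lK _ K1 Kmin] := aK.
have Kleast L : locally_normal L -> ~ L `<=` [set 1] -> germ_le K L.
  move=> lL L1; have KL1 := trivial_LC_meet LC01 lK lL K1 L1.
  have KKL : germ_le K (K `&` L).
    apply: Kmin => //; first exact: locally_normalI.
    by apply: sub_germ_le; exact: subIsetl.
  by apply: (germ_le_trans KKL); apply: sub_germ_le; exact: subIsetr.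
move=> g _ [B lB <-]; rewrite LN_conj_comm_class//.
have lgB := conj_set_locally_normal g lB.
have [B1|B1] := pselect (B `<=` [set 1]); last first.
  exact/comm_class_eqP/(least_germ_fixed hG lK lB K1 Kleast B1).
by rewrite !(iffRL (LN0_eqP _))//; exact/conj_set_trivial.
Qed.

(** The kernel of the action is an intersection of class stabilisers, each open because it contains
    a normaliser, hence closed. It is normal, so a nontrivial kernel is [G]. *)
Lemma action_dichotomy : ~ trivial_action (LN G) -> faithful_action (LN G).
Proof.
move=> ntriv g fixg; apply: contrapT => g1; apply: ntriv.
pose N := [set x : G | forall a, LN G a -> LN_conj x a = a].
have LN_conjM x y a : LN G a -> LN_conj (x * y) a = LN_conj x (LN_conj y a).
  move=> [K lK <-]; have lyK := conj_set_locally_normal y lK.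
  by rewrite !LN_conj_comm_class// conj_setM.
have LN_conjLN x a : LN G a -> LN G (LN_conj x a).
  move=> [K lK <-]; rewrite LN_conj_comm_class//; apply: LN_comm_class.
  exact: conj_set_locally_normal.
have LN_conj1 a : LN G a -> LN_conj 1 a = a.
  by move=> [K lK <-]; rewrite LN_conj_comm_class// conj_set1g.
pose F a := [set x : G | LN_conj x a = a].
have sF a : LN G a -> subgroup (F a).
  move=> La; apply/subgroupP; split=> [|x y Fx Fy]; first exact: LN_conj1.
  have Fy' : LN_conj y^-1 a = a.
    by rewrite -{1}Fy -LN_conjM// mulVg LN_conj1.
  by rewrite /F /= LN_conjM// Fy'.
have NE : N = \bigcap_(a in LN G) F a by apply/seteqP; split.
suff NT : N = setT by move=> x a La; have : N x by [rewrite NT]; exact.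
apply: (closed_normal_full hG).
- rewrite NE; apply: closed_bigI => a La; apply: open_subgroup_closed; first exact: sF.
  apply: subgroup_open; first exact: sF.
  case: La => K lK <-; apply: filterS (locally_normal_near1 lK) => x nx.
  by rewrite /F /= LN_conj_comm_class// nx.
- have Nconj y x : N x -> N (y * x * y^-1).
    move=> Nx a La; have La' := LN_conjLN y^-1 a La.
    by rewrite !LN_conjM ?Nx// -?LN_conjM// ?mulgV ?LN_conj1//; exact: LN_conjLN.
  apply/seteqP; split=> // y _; apply/normaliserP => x; apply/propext; split.
    by move=> /(Nconj y^-1); rewrite !gnorm.
  exact: Nconj.
- apply/subgroupP; split=> [a|x y Nx Ny a La]; first exact: LN_conj1.
  by have /subgroupP[_ h] := sF a La; apply: h; [exact: Nx|exact: Ny].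
- by exists g.
Qed.

Lemma trivial_LN_just_infinite U : LN G = [set LN0 G; LNoo G] ->
  compact_open_subgroup U -> hereditarily_just_infinite U.
Proof.
move=> LN01 cU; have [sU cpU oU] := cU; split.
  (* A finite [U] would make [1] isolated, against non-discreteness. *)
  move=> fU; have : \forall x \near (1 : G), forall u, (U `\` [set 1]) u -> x <> u.
    apply: near_finite; first exact: finite_setIl.
    by move=> u [_ u1]; exact: near1_neq.
  move=> /(filterI (compact_open_near1 cU)) /(near1_nontrivial hG)[x [Ux]].
  by move=> /(_ x) h x1; apply: h.
move=> V sV VU oV N clN [sN NV VN] N1.
(* As [U] is open and [V] is closed in [G], relative openness and closedness become absolute; [N] is
   then locally normal, since the open subgroup [V] normalises it. *)
have oV' : open V.
  by have := open_setIS V oU; rewrite (setIidl VU) => ->.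
have cV : compact V.
  by apply: (subclosed_compact _ cpU VU); exact: open_subgroup_closed.
have clV := compact_closed hausG cV.
have clN' : closed N.
  by have := closed_setIS N clV; rewrite (setIidl NV) => ->.
have cN : compact N := subclosed_compact clN' cV NV.
have cosV : compact_open_subgroup V by [].
have lN : locally_normal N by exact: (locally_normal_normalised _ _ cosV).
have : LN G (comm_class N) by exact: LN_comm_class.
rewrite LN01 => -[/(LN0_eqP lN) Nsub1|/(LNoo_eqP lN) Noo].
  case: N1; apply/seteqP; split => // _ ->; exact: subgroup1.
rewrite -(setIidr NV); apply: near1_finite_index => //.
exact: near_germ_le.
Qed.

End StructureLattice.

(** * The five cases: coverage and mutual exclusion *)

Lemma exists_unique_nth5 (p0 p1 p2 p3 p4 : Prop) :
  [\/ p0, p1, p2 | p3 \/ p4] ->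
  (p0 -> ~ [\/ p1, p2, p3 | p4]) -> (p1 -> ~ [\/ p2, p3 | p4]) ->
  (p2 -> ~ (p3 \/ p4)) -> (p3 -> ~ p4) ->
  exists! i : 'I_5, nth False [:: p0; p1; p2; p3; p4] i.
Proof.
move=> p h0 h1 h2 h3.
(* Each hypothesis excludes only later alternatives, which is enough since [i] and [j] are
   interchangeable. *)
have uniq (i j : 'I_5) : nth False [:: p0; p1; p2; p3; p4] i ->
    nth False [:: p0; p1; p2; p3; p4] j -> i = j.
  case: i j => -[|[|[|[|[|i]]]]] // Hi [[|[|[|[|[|j]]]]] // Hj] /= a b;
    try exact: val_inj; exfalso; by intuition (eauto using or3, or4).
have [i Hi] : exists i : 'I_5, nth False [:: p0; p1; p2; p3; p4] i.
  case: p => [?|?|?|[?|?]].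
  - by exists (@Ordinal 5 0 isT).
  - by exists (@Ordinal 5 1 isT).
  - by exists (@Ordinal 5 2 isT).
  - by exists (@Ordinal 5 3 isT).
  - by exists (@Ordinal 5 4 isT).
by exists i; split => // j; exact: uniq.
Qed.

Theorem theorem11 (G : topologicalGroupType) (hG : class_S G) :
  exists! i : 'I_5, nth False
    [:: LN G = [set LN0 G; LNoo G] /\
          (forall U : set G, compact_open_subgroup U ->
             hereditarily_just_infinite U);
        [/\ infinite_set (LN G), non_atomic (LN G), faithful_action (LN G) &
            LC G = [set LN0 G; LNoo G]];
        [/\ infinite_set (LC G), non_atomic (LC G) &
            LD G = [set LN0 G; LNoo G]];
        infinite_set (LD G) /\ non_atomic (LD G);
        [/\ LN G <> [set LN0 G; LNoo G], LC G = [set LN0 G; LNoo G] &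
            trivial_action (LN G)]] i.
Proof.
have LDLC := LD_sub_LC hG; have LCLN := LC_sub_LN hG; have LDLN := @LD_sub_LN G.
have fin2 L : L = [set LN0 G; LNoo G] -> finite_set L.
  by move=> ->; exact: finite_set2.
have LDoo := LDoo hG.
apply: exists_unique_nth5.
(* The cases are decided in the order: LN(G), LC(G), triviality of the action, LD(G). *)
- have [LN01|LN01] := pselect (LN G = [set LN0 G; LNoo G]).
    by apply: Or41; split=> // U; exact: trivial_LN_just_infinite.
  have [LC01|LC01] := pselect (LC G = [set LN0 G; LNoo G]).
    have [triv|ntriv] := pselect (trivial_action (LN G)).
      by apply: Or44; right; split.
    have na := LN_non_atomic hG LC01 ntriv.
    apply: Or42; split => //; last exact: action_dichotomy.
    by apply: non_atomic_infinite => //; exact/LCLN/LDLC.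
  have [LD01|LD01] := pselect (LD G = [set LN0 G; LNoo G]).
    have na := LC_non_atomic hG LC01.
    by apply: Or43; split => //; apply: non_atomic_infinite => //; exact: LDLC.
  have na := LD_non_atomic hG LD01.
  by apply: Or44; left; split => //; exact: non_atomic_infinite.
(* Finiteness passes from LN(G) to LC(G) to LD(G), which contradicts infinitude for most pairs.
   Cases (a) and (e) clash directly; (b) and (e) would make [G] act both faithfully and
   trivially. *)
- move=> [LN01 _]; have fLN := fin2 _ LN01; have fLC := sub_finite_set LCLN fLN.
  by case=> [[]|[]|[]|[]] //; have fLD := sub_finite_set LDLN fLN.
- move=> [_ _ fa LC01]; have fLC := fin2 _ LC01; have fLD := sub_finite_set LDLC fLC.
  case=> [[]|[]|[_ _ triv]] //.
  have [g g1] := nontrivial_group hG; apply: g1.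
  by apply: fa => a La; exact: triv.
- move=> [iLC _ LD01]; have fLD := fin2 _ LD01.
  by case=> [[]|[_ /fin2]].
- move=> [iLD _] [_ /fin2 fLC _]; apply: iLD.
  exact: sub_finite_set fLC.
Qed.
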